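(* Let $X$ be a geodesic metric space. Then the following are equivalent: (1) $X$ is (Gromov) hyperbolic; (2) $X$ has a finite homological isoperimetric function and $H^2_{(\infty)}(X;V)=0$ for all $1$-injective Banach spaces $V$; (3) $X$ has a finite homological isoperimetric function and $H^2_{(\infty)}(X;\ell^\infty(\mathbb N,\mathbb R))=0$.
   Context: Graphs and chains. A graph $Z$ is an undirected graph seen as a $1$-dimensional CW-complex, with vertex set $\mathcal V_Z$ and path metric $d$ in which every edge has length $1$. For $i\ge 0$, $C_i(Z)$ is the real vector space with basis $\mathcal V_Z^{i+1}$; for $R\in\mathbb N$, $C_i^R(Z)\subseteq C_i(Z)$ is the span of the tuples $(x_0,\dots,x_i)$ with $d(x_j,x_k)\le R$ for all $j,k$. These spaces carry the $\ell^1$-norm $|\cdot|_1$ with respect to these bases. $\partial\colon C_i(Z)\to C_{i-1}(Z)$ is the usual alternating boundary operator, and $B_i^R(Z)=\partial C_{i+1}^R(Z)$. For $b\in B_i^R(Z)$ the filling norm is $|b|_F^R=\inf\{|c|_1: c\in C_{i+1}^R(Z),\ \partial c=b\}$. Cohomology of graphs. For a normed vector space $V$, $C^i_{(\infty)}(Z;V)$ is the space of linear maps $f\colon C_i(Z)\to V$ such that $f|_{C_i^R(Z)}$ is bounded with respect to $|\cdot|_1$ for every $R\in\mathbb N$ (the bound may depend on $R$). With the usual coboundary $\delta f=f\circ\partial$ this is a cochain complex whose cohomology is denoted $H^\bullet_{(\infty)}(Z;V)$. Isoperimetric functions of graphs. A path in $Z$ is a finite sequence of oriented edges $e_1,\dots,e_l$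 with the head of $e_i$ equal to the tail of $e_{i+1}$; its length is $l$; it is closed if the tail of $e_1$ equals the head of $e_l$. For a path $p$, $\langle p\rangle\in C_1^1(Z)$ is the sum of the pairs (tail, head) of its oriented edges. $Z$ has a finite homological isoperimetric function if there exist a positive integer $R_0$ and a function $\theta\colon\mathbb N\to\mathbb R_{\ge0}$ such that for every closed path $p$ we have $\langle p\rangle\in B_1^{R_0}(Z)$ and $|\langle p\rangle|_F^{R_0}\le\theta(\mathrm{length}(p))$. Geodesic spaces. Every geodesic metric space $X$ is quasi-isometric to a connected graph. $H^\bullet_{(\infty)}(X;V)$ is defined as $H^\bullet_{(\infty)}(Z;V)$ for any connected graph $Z$ quasi-isometric to $X$ (this is well defined up to isomorphism, as $\ell^\infty$-cohomology of connected graphs is a quasi-isometry invariant). $X$ is said to have a finite homological isoperimetric function if some graph quasi-isometric to $X$ does. A Banach space $V$ is $1$-injective if every bounded linear map $f\colon U\to V$ defined on a subspace $U$ of a normed vector space $W$ extends to a linear map $F\colon W\to V$ with $|F|\le|f|$ (operator norms). $\ell^\infty(\mathbb N,\mathbb R)$ is the space of bounded real sequences with the sup norm. *)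

(* Defs.v *)
From HB Require Import structures.
From mathcomp Require Import all_boot all_order all_algebra finmap.
From mathcomp Require Import monalg.
From mathcomp Require Import all_classical all_reals all_analysis.

Set Implicit Arguments.
Unset Strict Implicit.
Unset Printing Implicit Defensive.
Import Order.TTheory GRing.Theory Num.Theory.
Import numFieldNormedType.Exports.
Local Open Scope classical_set_scope.
Local Open Scope ring_scope.

Section GeodesicSpaces.
Context {R : realType} (X : metricType R).
Implicit Types (x y z : X) (g : R -> X).

Definition geodesic_from_to g x y : Prop :=
  [/\ g 0 = x, g (mdist x y) = y &
      forall s t, 0 <= s <= mdist x y -> 0 <= t <= mdist x y ->
        mdist (g s) (g t) = `|s - t|].

Definition geodesic_space : Prop :=
  forall x y, exists g, geodesic_from_to g x y.

Definition geodesic_segment x y (S : set X) : Prop :=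
  exists2 g, geodesic_from_to g x y & S = g @` [set t | 0 <= t <= mdist x y].

(* Rips' condition: all geodesic triangles are uniformly slim.  One side is
   enough, as the condition is invariant under rotating the triangle. *)
Definition hyperbolic : Prop :=
  exists2 delta : R, 0 <= delta &
    forall x y z (S1 S2 S3 : set X),
      geodesic_segment x y S1 -> geodesic_segment y z S2 ->
      geodesic_segment z x S3 ->
      forall p, S1 p -> exists2 q, (S2 `|` S3) q & mdist p q <= delta.

End GeodesicSpaces.

(* A 1-dimensional CW-complex: every 1-cell [e] is a copy of [0, 1] whose ends
   0 and 1 are attached to [end_vertex e false] and [end_vertex e true].  Loops and
   multiple edges are allowed. *)
Record graph := Graph {
  vertex : choiceType;
  edge : Type;
  end_vertex : edge -> bool -> vertex
}.

Section Paths.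
Variable Z : graph.

(* [(e, b)] is the edge [e] travelled from its end [b] to its end [~~ b]. *)
Definition oriented_edge : Type := edge Z * bool.
Definition edge_tail (a : oriented_edge) : vertex Z := end_vertex a.1 a.2.
Definition edge_head (a : oriented_edge) : vertex Z := end_vertex a.1 (~~ a.2).

Fixpoint path_from_to (v : vertex Z) (p : seq oriented_edge) (w : vertex Z)
    : Prop :=
  if p is a :: p' then edge_tail a = v /\ path_from_to (edge_head a) p' w else v = w.

Definition closed_path (p : seq oriented_edge) : Prop :=
  exists v, path_from_to v p v.

Definition connected_graph : Prop := forall v w, exists p, path_from_to v p w.

End Paths.

Section PathMetric.
Variables (R : realType) (Z : graph).

(* The path metric on vertices; it is [+oo] between different components. *)
Definition vdist (v w : vertex Z) : \bar R :=
  ereal_inf [set (size p)%:R%:E | p in [set p | path_from_to v p w]].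

(* The points of the CW-complex: vertices, and points of the open 1-cells. *)
Inductive cw_point :=
| Vertex of vertex Z
| Inner (e : edge Z) (t : R) of 0 < t < 1.

(* The vertices that are reached from a point inside a single closed cell, with
   the lengths of the straight ways to them. *)
Definition exits (p : cw_point) : set (vertex Z * R) :=
  match p with
  | Vertex v => [set (v, 0)]
  | Inner e t _ => [set (end_vertex e false, t); (end_vertex e true, 1 - t)]
  end.

Definition same_edge_dist (p q : cw_point) : set R :=
  match p, q with
  | Inner e s _, Inner e' t _ => [set r | e = e' /\ r = `|s - t|]
  | _, _ => set0
  end.

Definition point_dist (p q : cw_point) : \bar R :=
  ereal_inf ([set (a.2%:E + vdist a.1 b.1 + b.2%:E)%E
                | a in exits p & b in exits q]
             `|` EFin @` same_edge_dist p q).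

End PathMetric.

Definition quasi_isometric {R : realType} (X : metricType R) (Z : graph) :
    Prop :=
  exists (f : X -> cw_point R Z) (L C : R),
    [/\ 1 <= L, 0 <= C,
        forall x y,
          ((L^-1 * mdist x y - C)%:E <= point_dist (f x) (f y)
             <= (L * mdist x y + C)%:E)%E &
        forall q, exists x, (point_dist (f x) q <= C%:E)%E].

Section Chains.
Variables (R : realType) (Z : graph).

(* The real vector space with basis the (i+1)-tuples of vertices. *)
Definition chain (i : nat) := {malg R[{ffun 'I_i.+1 -> vertex Z}]}.
HB.instance Definition _ i := GRing.Lmodule.on (chain i).

Definition l1norm i (c : chain i) : R := \sum_(x <- msupp c) `|c@_x|.

Definition face i (j : 'I_i.+2) (x : {ffun 'I_i.+2 -> vertex Z}) :
    {ffun 'I_i.+1 -> vertex Z} :=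
  [ffun k => x (lift j k)].

Definition boundary i (c : chain i.+1) : chain i :=
  \sum_(x <- msupp c) c@_x *: \sum_(j < i.+2) (-1) ^+ j *: << face j x >>.

Definition small_tuple (r : nat) i (x : {ffun 'I_i.+1 -> vertex Z}) : Prop :=
  forall j k, (vdist R (x j) (x k) <= r%:R%:E)%E.

Definition small_chain (r : nat) i : set (chain i) :=
  [set c | forall x, x \in msupp c -> small_tuple r x].

Definition small_boundary (r : nat) i : set (chain i) :=
  @boundary i @` @small_chain r i.+1.

(* The infimum is meaningful only when [b] is in [small_boundary r]. *)
Definition filling_norm (r : nat) i (b : chain i) : R :=
  inf [set l1norm c | c in [set c | small_chain r c /\ boundary c = b]].

Definition path_chain (p : seq (oriented_edge Z)) : chain 1 :=
  \sum_(a <- p) << [ffun k : 'I_2 => if k == ord0 then edge_tail a else edge_head a] >>.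

End Chains.

Definition graph_finite_isoperimetric (R : realType) (Z : graph) : Prop :=
  exists (r : nat) (theta : nat -> R),
    [/\ (0 < r)%N, forall n, 0 <= theta n &
        forall p : seq (oriented_edge Z), closed_path p ->
          small_boundary r (path_chain R p) /\
          filling_norm r (path_chain R p) <= theta (size p)].

Definition finite_isoperimetric {R : realType} (X : metricType R) : Prop :=
  exists Z : graph, quasi_isometric X Z /\ graph_finite_isoperimetric R Z.

Section Cohomology.
Variables (R : realType) (Z : graph) (V : normedModType R).

Definition cochain i : set (chain R Z i -> V) :=
  [set f | linear f /\
           forall r : nat, exists M : R,
             forall c, small_chain r c -> `|f c| <= M * l1norm c].

Definition coboundary i (f : chain R Z i -> V) :
    chain R Z i.+1 -> V :=
  f \o @boundary R Z i.

Definition cocycles i : set (chain R Z i -> V) :=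
  [set f | cochain f /\ coboundary f = cst 0].

Definition coboundaries i : set (chain R Z i -> V) :=
  match i with
  | 0 => [set cst 0]
  | j.+1 => @coboundary j @` @cochain j
  end.

Definition graph_cohomology_vanishes i : Prop :=
  @cocycles i `<=` @coboundaries i.

End Cohomology.

Definition cohomology_vanishes {R : realType} (X : metricType R)
    (V : normedModType R) (i : nat) : Prop :=
  forall Z : graph, connected_graph Z -> quasi_isometric X Z ->
    graph_cohomology_vanishes Z V i.

Section Injective.
Context {R : realType}.

(* Linear maps [U -> V] on a subspace [U] of [W] are represented by maps on [W]
   whose values outside of [U] are irrelevant. *)
Definition linear_on (W V : normedModType R) (U : {pred W}) (f : W -> V) :
    Prop :=
  forall a, {in U &, forall x y, f (a *: x + y) = a *: f x + f y}.

Definition operator_bounds (W V : normedModType R) (U : {pred W})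
    (f : W -> V) : set R :=
  [set M | 0 <= M /\ {in U, forall x, `|f x| <= M * `|x|}].

Definition opnorm (W V : normedModType R) (U : {pred W}) (f : W -> V) : R :=
  inf (operator_bounds U f).

Definition one_injective (V : completeNormedModType R) : Prop :=
  forall (W : normedModType R) (U : {pred W}) (f : W -> V),
    submod_closed U -> linear_on U f -> operator_bounds U f !=set0 ->
    exists F : {linear W -> V},
      [/\ {in U, F =1 f}, operator_bounds predT F !=set0 &
          opnorm predT F <= opnorm U f].

End Injective.

Section BoundedSequences.
Variable R : realType.

Definition bounded_seq : {pred (nat -> R)} :=
  [pred u : nat -> R | `[< has_ubound (range (fun n => `|u n|)) >]].

Lemma bounded_seqP (u : nat -> R) :
  reflect (exists M, forall n, `|u n| <= M) (u \in bounded_seq).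
Proof.
apply: (iffP (asboolP _)) => -[M hM]; exists M.
  by move=> n; apply: hM; exists n.
by move=> _ [n _ <-].
Qed.

Record linf := Linf { linf_val :> nat -> R; linf_valP : linf_val \in bounded_seq }.

HB.instance Definition _ := [isSub for linf_val].
HB.instance Definition _ := [Choice of linf by <:].

Lemma bounded_seq_submod : submod_closed bounded_seq.
Proof.
split; first by apply/bounded_seqP; exists 0 => n; rewrite normr0.
move=> a u v /bounded_seqP[M hM] /bounded_seqP[N hN].
apply/bounded_seqP; exists (`|a| * M + N) => n.
rewrite (le_trans (ler_normD _ _))// lerD// normrM.
exact: ler_wpM2l.
Qed.

HB.instance Definition _ :=
  GRing.isSubmodClosed.Build R (nat -> R) bounded_seq bounded_seq_submod.
HB.instance Definition _ := [SubChoice_isSubLmodule of linf by <:].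

Definition linf_norm (u : linf) : R := sup (range (fun n => `|u n|)).

Lemma linf_has_sup (u : linf) : has_sup (range (fun n => `|u n|)).
Proof.
split; first by exists `|u 0|; exists 0.
exact/asboolP/(linf_valP u).
Qed.

Lemma le_linf_norm (u : linf) n : `|u n| <= linf_norm u.
Proof. by apply: sup_upper_bound; [exact: linf_has_sup|exists n]. Qed.

Lemma linf_norm_le (u : linf) M : (forall n, `|u n| <= M) -> linf_norm u <= M.
Proof.
move=> hM; apply: ge_sup; first by have [] := linf_has_sup u.
by move=> _ [n _ <-].
Qed.

Lemma linf_normD (u v : linf) : linf_norm (u + v) <= linf_norm u + linf_norm v.
Proof.
apply: linf_norm_le => n.
by rewrite (le_trans (ler_normD _ _))// lerD// le_linf_norm.
Qed.

Lemma linf_normZ (a : R) (u : linf) : linf_norm (a *: u) = `|a| * linf_norm u.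
Proof.
have le_normZ (b : R) (v : linf) : linf_norm (b *: v) <= `|b| * linf_norm v.
  by apply: linf_norm_le => n; rewrite normrM ler_wpM2l// le_linf_norm.
apply/eqP; rewrite eq_le le_normZ/=.
have [->|a0] := eqVneq a 0.
  rewrite normr0 mul0r.
  exact: le_trans (normr_ge0 _) (le_linf_norm _ 0).
rewrite mulrC -ler_pdivlMr ?normr_gt0// mulrC -normfV.
rewrite -[X in linf_norm X <= _](scalerK a0).
exact: le_normZ.
Qed.

Lemma linf_norm0_eq0 (u : linf) : linf_norm u = 0 -> u = 0.
Proof.
move=> u0; apply: val_inj; apply/funext => n /=.
by apply/eqP; rewrite -normr_le0 -u0 le_linf_norm.
Qed.

HB.instance Definition _ :=
  Lmodule_isNormed.Build R linf linf_normD linf_normZ linf_norm0_eq0.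

Lemma linf_complete (F : set_system linf) :
  ProperFilter F -> cauchy F -> cvg F.
Proof.
move=> FF Fc.
have Fc1 (e : R) : 0 < e ->
    exists2 A, F A & forall u v, A u -> A v -> `|u - v| < e.
  move=> e0; have /cauchy_ballP/(_ _ e0)[[A B] [/= FA FB] AB] := Fc.
  exists (A `&` B); first exact: filterI.
  move=> u v [Au _] [_ Bv].
  by have := AB (u, v) (conj Au Bv); rewrite -ball_normE.
have coord (u v : linf) n : `|u n - v n| <= `|u - v| := le_linf_norm (u - v) n.
have Gc n : cvg ((fun u : linf => u n) @ F).
  apply: cauchy_cvg; apply/cauchy_ballP => e e0.
  have [A FA hA] := Fc1 _ e0.
  exists ([set u n | u in A], [set u n | u in A]) => /=.
    by split; apply: (@filterS _ F _ A) => // u Au; exists u.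
  move=> [_ _] [/= [u Au <-] [v Av <-]].
  by rewrite -ball_normE /ball_/= (le_lt_trans (coord _ _ _))// hA.
pose l n := lim ((fun u : linf => u n) @ F).
have le_l (e : R) A : F A -> (forall u v, A u -> A v -> `|u - v| < e) ->
    forall u n, A u -> `|l n - u n| <= e.
  move=> FA hA u n Au; apply/ler_addgt0Pr => d d0.
  have /cvgrPdist_lt/(_ _ d0) Gd := Gc n.
  have [v [Av /= vd]] := filter_ex (filterI FA Gd).
  rewrite -(subrKA (v n)) (le_trans (ler_normD _ _))// addrC lerD//.
    by rewrite (le_trans (coord _ _ _))// ltW// hA.
  exact: ltW.
have [A FA hA] := Fc1 _ ltr01; have [u Au] := filter_ex FA.
have bl : l \in bounded_seq.
  apply/bounded_seqP; exists (1 + `|u|) => n.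
  rewrite -(subrK (u n) (l n)) (le_trans (ler_normD _ _))// lerD//.
    exact: le_l Au.
  exact: le_linf_norm.
apply/cvg_ex; exists (Linf bl); apply/cvgrPdist_le => e e0.
have [B FB hB] := Fc1 _ e0.
apply: (filterS _ FB) => v Bv.
by apply: linf_norm_le => n; exact: (le_l e B FB hB v n Bv).
Qed.

HB.instance Definition _ := Uniform_isComplete.Build linf linf_complete.

End BoundedSequences.

(* Main.v *)
(* If [X] is hyperbolic, a closed path of unit steps that is long enough has a
   shortcut: at a point farthest from a base point, the stretch of [m] steps to
   either side cannot be geodesic.  Cutting off loops of bounded size one by one
   fills the path with linearly many 2-simplices.  Hence, for a 2-cocycle [F], the
   functional given by [F o x y] is bounded on 1-cycles, and its extension to all
   1-chains, which exists as [V] is 1-injective, yields a primitive of [F].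

   Conversely, let the cohomology with coefficients in [linf R] vanish.  For
   1-Lipschitz functions [f] and [g] the 2-cocycles
   [(f y - f x) * (g z - g y)] are bounded on small triples uniformly in [f] and [g],
   so sequences of them are cocycles with values in [linf R].  Their primitives give
   a bound of the integral of [f dg] over a closed path by a constant times its
   length.  If a geodesic triangle has a point [x] on its side [a, b] at distance [t]
   from the other sides, but is not much fatter than that elsewhere, then a stretch
   of [a, b] around [x] closes up to a loop of length O(t) outside the ball of radius
   [t] around [x].  With [f] the bump function of this ball and [g] the distance to
   [a], the integral is at least [t ^ 2 / 2], so [t] is bounded. *)
From HB Require Import structures.
Require Import Defs.
From mathcomp Require Import all_boot all_order all_algebra finmap monalg.
From mathcomp Require Import all_classical all_reals all_analysis.
From mathcomp Require Import ring lra zify.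

Set Implicit Arguments.
Unset Strict Implicit.
Unset Printing Implicit Defensive.
Import Order.TTheory GRing.Theory Num.Theory.
Import numFieldNormedType.Exports.
Local Open Scope classical_set_scope.
Local Open Scope ring_scope.

(** * The Hahn-Banach theorem *)

Section HahnBanach.
Variables (R : realType) (W : lmodType R) (p : W -> R).
Hypothesis pD : forall x y, p (x + y) <= p x + p y.
Hypothesis pZ : forall a x, 0 <= a -> p (a *: x) = a * p x.

(* The graph of a [p]-dominated linear functional on a subspace of [W]; the
   empty set is allowed, so that Zorn's lemma applies to the empty chain. *)
Definition dominated_graph (G : set (W * R)) : Prop :=
  (forall a u v, G u -> G v -> G (a *: u.1 + v.1, a * u.2 + v.2)) /\
  (forall u, G u -> u.2 <= p u.1).

(** The value [al] at [x0] has to lie between the numbers [u.2 - p (u.1 - x0)] and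
    [p (v.1 + x0) - v.2]. Subadditivity separates the two sets, and the supremum of the first will
    do; homogeneity reduces a multiple [t *: x0] to the cases [t = 1] and [t = -1]. *)
Lemma dominated_graph_extend (G : set (W * R)) (x0 : W) :
  dominated_graph G -> G (0, 0) ->
  exists al : R, dominated_graph
    [set w | exists u t, G u /\ w = (u.1 + t *: x0, u.2 + t * al)].
Proof.
move=> [Gl Gp] G0.
have GZ a u : G u -> G (a *: u.1, a * u.2).
  by move=> /(Gl a _ _)/(_ G0)/=; rewrite !addr0.
have key u v : G u -> G v -> u.2 - p (u.1 - x0) <= p (v.1 + x0) - v.2.
  move=> Gu Gv.
  have := Gp _ (Gl 1 _ _ Gu Gv) => /=; rewrite scale1r mul1r => h.
  have := pD (u.1 - x0) (v.1 + x0).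
  rewrite addrA addrAC subrK => h'.
  by lra.
pose S := [set u.2 - p (u.1 - x0) | u in G].
have S0 : S !=set0 by exists ((0 : R) - p (0 - x0)), (0, 0).
have Sub v : G v -> ubound S (p (v.1 + x0) - v.2).
  by move=> Gv _ [u Gu <-]; exact: key.
have al_ub v : G v -> sup S <= p (v.1 + x0) - v.2.
  by move=> Gv; apply: ge_sup => // ; exact: Sub.
have al_lb u : G u -> u.2 - p (u.1 - x0) <= sup S.
  move=> Gu; apply: sup_upper_bound; last by exists u.
  by split => //; exists (p (0 + x0) - 0); exact: (Sub (0, 0)).
exists (sup S); split.
  move=> a _ _ [u [s [Gu ->]]] [v [t [Gv ->]]] /=.
  exists (a *: u.1 + v.1, a * u.2 + v.2), (a * s + t); split; first exact: Gl.
  congr pair => /=; last by ring.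
  by rewrite scalerDr scalerA scalerDl addrACA.
move=> _ [u [t [Gu ->]]] /=.
have [t0|t0|->] := ltrgtP t 0; last by rewrite scale0r mul0r !addr0; exact: Gp.
- have s0 : 0 < - t by rewrite oppr_gt0.
  have := al_lb _ (GZ (- t)^-1 _ Gu) => /=.
  have -> : (- t)^-1 *: u.1 - x0 = (- t)^-1 *: (u.1 + t *: x0).
    by rewrite scalerDr scalerA invrN mulNr mulVf ?lt_eqF// scaleN1r.
  rewrite pZ; last by rewrite invr_ge0 ltW.
  rewrite -mulrBr mulrC ler_pdivrMr// => h.
  by lra.
- have := al_ub _ (GZ t^-1 _ Gu) => /=.
  have -> : t^-1 *: u.1 + x0 = t^-1 *: (u.1 + t *: x0).
    by rewrite scalerDr scalerA mulVf ?gt_eqF// scale1r.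
  rewrite pZ; last by rewrite invr_ge0 ltW.
  rewrite -mulrBr mulrC ler_pdivlMr// => h.
  by lra.
Qed.

Lemma hahn_banach (U : {pred W}) (f : W -> R) :
  submod_closed U ->
  (forall a, {in U &, forall x y, f (a *: x + y) = a * f x + f y}) ->
  {in U, forall x, f x <= p x} ->
  exists F : W -> R,
    [/\ forall a x y, F (a *: x + y) = a * F x + F y, {in U, F =1 f} &
        forall x, F x <= p x].
Proof.
move=> [U0 UD] fl fp.
pose Gf : set (W * R) := [set u | u.1 \in U /\ u.2 = f u.1].
have f0 : f 0 = 0.
  have := fl 1 _ _ U0 U0; rewrite scale1r mul1r addr0 => h.
  by apply: (addrI (f 0)); rewrite -h addr0.
have dGf : dominated_graph Gf.
  split.
    move=> a [u r] [v s] [/= Uu ->] [/= Uv ->]; split => /=; first exact: UD.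
    by rewrite fl.
  by move=> [u r] [/= Uu ->]; exact: fp.
have Gf0 : Gf (0, 0) by split.
(* Only a nonempty [G] has to contain [Gf], so that the union of an empty chain qualifies. *)
pose P (G : set (W * R)) := dominated_graph G /\ (G !=set0 -> Gf `<=` G).
have [|G [[dG GGf] Gmax]] := @Zorn_bigcup _ P.
  move=> FF FP Ftot; split.
    split.
      move=> a u v [A FA Au] [B FB Bv].
      have [[dA _] _] := FP _ FA; have [[dB _] _] := FP _ FB.
      by have [AB|BA] := Ftot _ _ FA FB;
        [exists B => //; apply: dB => //; exact: AB
        |exists A => //; apply: dA => //; exact: BA].
    by move=> u [A FA Au]; have [[_ +] _] := FP _ FA; apply.
  move=> [u [A FA Au]] v Gfv; exists A => //.
  by have [_ +] := FP _ FA; apply => //; exists u.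
(* A maximal set is nonempty, as [Gf] is strictly larger than the empty set. *)
have {}GGf : Gf `<=` G.
  apply: GGf; apply: contrapT => /set0P/negP/negPn/eqP G0.
  apply: (Gmax Gf); last by split => // _.
  by rewrite G0; split => // /(_ _ Gf0).
have GF x : exists r, G (x, r).
  have [al dG'] := dominated_graph_extend x dG (GGf _ Gf0).
  set G' := (X in dominated_graph X) in dG'.
  have GG' : G `<=` G'.
    by move=> [u r] Gu; exists (u, r), 0; rewrite scale0r mul0r !addr0.
  have G'x : G' (x, al).
    by exists (0, 0), 1; split; [exact: GGf|rewrite scale1r mul1r !add0r].
  have [G'G|nG'G] := pselect (G' `<=` G); first by exists al; exact: G'G.
  exfalso; apply: (Gmax G'); first by split.
  by split => // _ u Gfu; exact/GG'/GGf.
have [F FG] := choice GF.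
have [Gl Gp] := dG.
(* The difference of two values over the same [x] is dominated by [p 0 = 0]. *)
have uniq x r s : G (x, r) -> G (x, s) -> r <= s.
  move=> Gr Gs; have := Gp _ (Gl (-1) _ _ Gs Gr) => /=.
  rewrite scaleN1r addNr mulN1r.
  have -> : p 0 = 0 by rewrite -(scale0r 0) pZ// mul0r.
  by lra.
have FE x r : G (x, r) -> F x = r.
  by move=> Gr; apply/le_anti; rewrite !(uniq x).
exists F; split.
- by move=> a x y; apply: FE; exact: (Gl a _ _ (FG x) (FG y)).
- by move=> x Ux; apply: FE; exact: GGf.
- by move=> x; exact: (Gp _ (FG x)).
Qed.
End HahnBanach.

Section NormedHahnBanach.
Variables (R : realType) (W : normedModType R).

(** The dominating function is symmetric, so the one-sided bound at [- x] gives the other half of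
    the two-sided one. *)
Lemma hahn_banach_normed (U : {pred W}) (f : W -> R) (M : R) : 0 <= M ->
  submod_closed U ->
  (forall a, {in U &, forall x y, f (a *: x + y) = a * f x + f y}) ->
  {in U, forall x, `|f x| <= M * `|x|} ->
  exists F : W -> R,
    [/\ forall a x y, F (a *: x + y) = a * F x + F y, {in U, F =1 f} &
        forall x, `|F x| <= M * `|x|].
Proof.
move=> M0 Usub fl fM.
have [||x Ux|F [Fl Ff FM]] := @hahn_banach R W (fun x => M * `|x|) _ _ U f Usub fl.
- by move=> x y; rewrite -mulrDr ler_wpM2l// ler_normD.
- by move=> a x a0; rewrite normrZ ger0_norm// mulrCA.
- exact: le_trans (ler_norm _) (fM _ Ux).
exists F; split => // x; rewrite ler_norml FM andbT lerNl.
have F0 : F 0 = 0.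
  have := Fl 1 0 0; rewrite scale1r mul1r addr0 => h.
  by apply: (addrI (F 0)); rewrite -h addr0.
have := Fl (-1) x 0; rewrite addr0 F0 addr0 mulN1r => <-.
by rewrite scaleN1r -[X in _ <= _ * X]normrN FM.
Qed.

Lemma norming_functional (v : W) :
  exists F : W -> R,
    [/\ forall a x y, F (a *: x + y) = a * F x + F y, F v = `|v| &
        forall x, `|F x| <= `|x|].
Proof.
have [->|v0] := eqVneq v 0.
  exists (cst 0); split => [a x y||x] /=; rewrite ?mulr0 ?addr0 ?normr0//.
pose U : {pred W} := [pred x | `[< exists a, x = a *: v >]].
(* The coefficient is picked by choice; it is unique as [v] is not 0, which gives [fE]. *)
pose f x := if pselect (exists a, x = a *: v) is left h then sval (cid h) * `|v|
            else 0.
have fE a : f (a *: v) = a * `|v|.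
  rewrite /f; case: pselect => [h|[]]; last by exists a.
  case: cid => /= b /eqP.
  by rewrite -subr_eq0 -scalerBl scaler_eq0 (negPf v0) orbF subr_eq0 => /eqP ->.
have UP x : reflect (exists a, x = a *: v) (x \in U) by exact: asboolP.
have [|||F [Fl Ff FM]] := @hahn_banach_normed U f 1 ler01.
- split; first by apply/UP; exists 0; rewrite scale0r.
  move=> a _ _ /UP[b ->] /UP[c ->]; apply/UP; exists (a * b + c).
  by rewrite scalerDl scalerA.
- move=> a _ _ /UP[b ->] /UP[c ->].
  by rewrite scalerA -scalerDl !fE mulrDl mulrA.
- by move=> _ /UP[b ->]; rewrite fE normrM normr_id normrZ mul1r.
exists F; split => // [|x]; last by rewrite -[leRHS]mul1r.
rewrite Ff; last by apply/UP; exists 1; rewrite scale1r.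
by rewrite -[X in f X]scale1r fE mul1r.
Qed.

End NormedHahnBanach.

(** Hahn-Banach extends every coordinate with the same constant [opnorm U f], so the extensions form
    a bounded sequence whose norm obeys that constant. *)
Lemma linf_one_injective (R : realType) : one_injective (linf R).
Proof.
move=> W U f Usub fl [M0 hM0].
pose M := opnorm U f.
have Mlb : has_inf (operator_bounds U f).
  by split; [exists M0|exists 0 => K []].
have M_ge0 : 0 <= M by apply: lb_le_inf; [exists M0|move=> K []].
(* The infimum that defines [opnorm] is itself a bound. *)
have fM : {in U, forall x, `|f x| <= M * `|x|}.
  move=> x Ux; have [->|x0] := eqVneq x 0.
    have [U0 _] := Usub; have := fl 0 _ _ U0 U0.
    by rewrite !scale0r !add0r => _; case: hM0 => _ /(_ _ U0); rewrite normr0 !mulr0.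
  rewrite -ler_pdivrMr ?normr_gt0//; apply: lb_le_inf; first by exists M0.
  by move=> K [_ /(_ _ Ux)]; rewrite ler_pdivrMr ?normr_gt0.
have coord n : exists F : W -> R,
    [/\ forall a x y, F (a *: x + y) = a * F x + F y,
        {in U, F =1 fun x => f x n} & forall x, `|F x| <= M * `|x|].
  apply: hahn_banach_normed => //.
    by move=> a x y Ux Uy; rewrite fl.
  by move=> x Ux; exact: le_trans (le_linf_norm _ n) (fM _ Ux).
have [F hF] := choice coord.
have bF x : (fun n => F n x) \in @bounded_seq R.
  by apply/bounded_seqP; exists (M * `|x|) => n; have [_ _] := hF n.
pose G x : linf R := Linf (bF x).
have Gl : linear G.
  move=> a x y; apply/val_inj/funext => n /=.
  by have [Fl _ _] := hF n; rewrite Fl.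
pose GL : {linear W -> linf R} := HB.pack G (GRing.isLinear.Build _ _ _ _ G Gl).
have GM x : `|G x| <= M * `|x|.
  by apply: linf_norm_le => n; have [_ _ h] := hF n; exact: h.
exists GL; split.
- move=> x Ux; apply/val_inj/funext => n /=.
  by have [_ Ff _] := hF n; rewrite Ff.
- by exists M; split => // x _; exact: GM.
- by apply: ge_inf; [exists 0 => K []|split => // x _; exact: GM].
Qed.

(** * Finitely supported chains *)

Section LinearExtension.
Variables (R : realType) (K : choiceType) (V : lmodType R).
Implicit Types (a : K -> V) (c d : {malg R[K]}).

Definition lext a c : V := \sum_(k <- msupp c) c@_k *: a k.

Lemma lextEw a c (D : {fset K}) : (msupp c `<=` D)%fset ->
  lext a c = \sum_(k <- D) c@_k *: a k.
Proof.
move=> le; rewrite [LHS](big_fset_incl _ le)//= => k _ /mcoeff_outdom ->.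
by rewrite scale0r.
Qed.

Lemma lextU a k : lext a << k >> = a k.
Proof.
by rewrite (lextEw _ msuppU_le) big_seq_fset1 mcoeffUU scale1r.
Qed.

Lemma lext_linear a : linear (lext a).
Proof.
move=> t c d; pose D := (msupp c `|` msupp d)%fset.
rewrite !(@lextEw _ _ D) ?fsubsetUl ?fsubsetUr//; last first.
  apply: fsubset_trans (msuppD_le _ _) _; apply: fsetSU; exact: msuppZ_le.
rewrite scaler_sumr -big_split/=; apply: eq_bigr => k _.
by rewrite mcoeffD mcoeffZ scalerDl scalerA.
Qed.

HB.instance Definition _ a :=
  GRing.isLinear.Build R {malg R[K]} V _ (lext a) (@lext_linear a).

Lemma linear_lextE (f : {malg R[K]} -> V) : linear f ->
  f =1 lext (fun k => f << k >>).
Proof.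
move=> fl c.
pose F : {linear {malg R[K]} -> V} :=
  HB.pack f (GRing.isLinear.Build _ _ _ _ f fl).
rewrite [in LHS](monalgE c) -[f]/(F : _ -> _) raddf_sum /=.
apply: eq_bigr => k _.
transitivity (F (c@_k *: << k >>)); last by rewrite linearZ.
congr f.
by apply/malgP => k'; rewrite mcoeffZ !mcoeffU; case: eqP; rewrite ?mulr1 ?mulr0.
Qed.

End LinearExtension.

Section L1Norm.
Variables (R : realType) (K : choiceType).
Implicit Types (c d : {malg R[K]}).

Definition l1 c : R := \sum_(k <- msupp c) `|c@_k|.

Lemma l1Ew c (D : {fset K}) : (msupp c `<=` D)%fset ->
  l1 c = \sum_(k <- D) `|c@_k|.
Proof.
move=> le; rewrite [LHS](big_fset_incl _ le)//= => k _ /mcoeff_outdom ->.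
by rewrite normr0.
Qed.

Lemma l1U k : l1 << k >> = 1.
Proof.
by rewrite (l1Ew msuppU_le) big_seq_fset1 mcoeffUU normr1.
Qed.

Lemma l1_ge0 c : 0 <= l1 c.
Proof. by apply: sumr_ge0. Qed.

Lemma l1D c d : l1 (c + d) <= l1 c + l1 d.
Proof.
pose D := (msupp c `|` msupp d)%fset.
rewrite !(@l1Ew _ D) ?fsubsetUl ?fsubsetUr ?msuppD_le// -big_split/=.
by apply: ler_sum => k _; rewrite mcoeffD ler_normD.
Qed.

Lemma l1Z t c : l1 (t *: c) = `|t| * l1 c.
Proof.
rewrite (l1Ew (msuppZ_le t c)) /l1 mulr_sumr; apply: eq_bigr => k _.
by rewrite mcoeffZ normrM.
Qed.

Lemma l1_eq0 c : l1 c = 0 -> c = 0.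
Proof.
move=> c0; apply/malgP => k; rewrite mcoeff0.
have [ksupp|//] := msuppP c k.
apply/eqP; rewrite -normr_le0 -c0 /l1 (big_fsetD1 k)//= lerDl.
exact: sumr_ge0.
Qed.

Lemma l1N c : l1 (- c) = l1 c.
Proof. by rewrite -scaleN1r l1Z normrN1 mul1r. Qed.

(** Only the values on the support of [c] enter, so bounds on small tuples carry over to small
    chains. *)
Lemma ler_norm_lext (V : normedModType R) (a : K -> V) (M : R) c :
  (forall k, k \in msupp c -> `|a k| <= M) -> `|lext a c| <= M * l1 c.
Proof.
move=> aM; rewrite mulr_sumr (le_trans (ler_norm_sum _ _ _))//.
rewrite big_seq [leRHS]big_seq; apply: ler_sum => k kc.
by rewrite normrZ mulrC ler_wpM2r// aM.
Qed.

(** A separate name for the chains, to which the norm is attached. *)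
Definition l1space : Type := {malg R[K]}.
HB.instance Definition _ := GRing.Lmodule.on l1space.
HB.instance Definition _ := Lmodule_isNormed.Build R l1space l1D l1Z l1_eq0.

End L1Norm.

(** * Graphs and coarse cohomology *)

Section GraphPaths.
Variable Z : graph.
Implicit Types (u v w : vertex Z) (p q : seq (oriented_edge Z)) (n : nat).

Lemma path_from_to_cat u v w p q :
  path_from_to u p v -> path_from_to v q w -> path_from_to u (p ++ q) w.
Proof.
by elim: p u => [u ->//|a p IH u /= [-> /IH h] /h].
Qed.

Definition reverse_edge (a : oriented_edge Z) : oriented_edge Z := (a.1, ~~ a.2).

Lemma path_from_to_rev v w p :
  path_from_to v p w -> path_from_to w (rev (map reverse_edge p)) v.
Proof.
elim: p v => [v ->//|a p IH v /= [<- /IH h]].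
rewrite rev_cons -cats1; apply: path_from_to_cat h _ => /=; split => //.
by rewrite /edge_head /edge_tail /= negbK.
Qed.

Definition near_vertices n v w : Prop :=
  exists2 p, path_from_to v p w & (size p <= n)%N.

Lemma near_verticesxx v : near_vertices 0 v v.
Proof. by exists [::]. Qed.

Lemma near_verticesC n v w : near_vertices n v w -> near_vertices n w v.
Proof.
move=> [p vp pn]; exists (rev (map reverse_edge p)).
  exact: path_from_to_rev.
by rewrite size_rev size_map.
Qed.

Lemma near_verticesW m n v w :
  (m <= n)%N -> near_vertices m v w -> near_vertices n v w.
Proof. by move=> mn [p vp pm]; exists p => //; exact: leq_trans mn. Qed.

Lemma near_vertices_trans m n u v w :
  near_vertices m u v -> near_vertices n v w -> near_vertices (m + n) u w.
Proof.
move=> [p up pm] [q vq qn]; exists (p ++ q); first exact: path_from_to_cat vq.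
by rewrite size_cat leq_add.
Qed.

Lemma near_vertices_edge (e : edge Z) (b b' : bool) :
  near_vertices 1 (end_vertex e b) (end_vertex e b').
Proof.
have [->|bb'] := eqVneq b b'.
  exact: (near_verticesW _ (near_verticesxx _)).
exists [:: (e, b)] => //=; split => //.
by rewrite /edge_head/=; case: b b' bb' => [] [].
Qed.

(** Path lengths are integers: if their infimum is at most [n], some path has length below
    [n.+1]. *)
Lemma vdist_leP (R : realType) n v w :
  (vdist R v w <= n%:R%:E)%E <-> near_vertices n v w.
Proof.
split=> [vw|[p vp pn]]; last first.
  by apply: ereal_inf_le; exists (size p)%:R%:E; [exists p|rewrite lee_fin ler_nat].
have : (vdist R v w < n.+1%:R%:E)%E.
  by apply: le_lt_trans vw _; rewrite lte_fin ltr_nat.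
move=> /ereal_inf_lt[_ [p vp <-]]; rewrite lte_fin ltr_nat ltnS => pn.
by exists p.
Qed.

End GraphPaths.

Lemma zmod_eq_intro (V : zmodType) (x y : V) : 0 + x - y = 0 -> x = y.
Proof. by rewrite add0r => /eqP; rewrite subr_eq0 => /eqP. Qed.

(* Cancels the last summand against an earlier one until nothing is left. *)
Ltac zmod_eq :=
  apply: zmod_eq_intro; rewrite ?(opprD, opprK, addrA);
  repeat match goal with
  | |- ?s - ?x = 0 => repeat progress rewrite (addrAC _ x); rewrite subrK
  | |- ?s + ?x = 0 => repeat progress rewrite (addrAC _ (- x)); rewrite addrK
  end; reflexivity.

(** * Degree-two cohomology of sets with a nearness relation *)

Section CoarseCohomology.
Variable R : realType.

Definition cocycle2 (T : Type) (V : zmodType) (F : T -> T -> T -> V) : Prop :=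
  forall x y z w, F y z w - F x z w + F x y w - F x y z = 0.

(** Written with functions on triples and an abstract scale relation, the vanishing makes sense for
    [X] itself and for the vertices of a graph alike. *)
Definition coarse_vanishing (T : Type) (near : nat -> T -> T -> Prop)
    (V : normedModType R) : Prop :=
  forall F : T -> T -> T -> V, cocycle2 F ->
    (forall r, exists M : R, forall x y z,
       near r x y -> near r x z -> near r y z -> `|F x y z| <= M) ->
    exists2 g : T -> T -> V,
      (forall r, exists M : R, forall x y, near r x y -> `|g x y| <= M) &
      forall x y z, F x y z = g y z - g x z + g x y.

Lemma cocycle2E (T : Type) (V : zmodType) (F : T -> T -> T -> V) :
  cocycle2 F -> forall x y z w, F y z w - F x z w = F x y z - F x y w.
Proof.
move=> Fc x y z w; have /eqP := Fc x y z w.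
by rewrite -addrA addr_eq0 opprB => /eqP.
Qed.

(** Coning off from [o]. The primitive [F o] is in general not bounded on near pairs, since [o] may
    be far from them. *)
Lemma cocycle2_primitive (T : Type) (V : zmodType) (F : T -> T -> T -> V) o :
  cocycle2 F -> forall x y z, F x y z = F o y z - F o x z + F o x y.
Proof.
move=> Fc x y z; have /eqP := cocycle2E Fc o x y z.
by rewrite subr_eq => /eqP ->; zmod_eq.
Qed.

(* With [h = phi \o psi], the prism operator
   [P v w = F v w (h w) - F v (h v) (h w)] is a primitive of
   [F - F (h _) (h _) (h _)]. *)
Lemma coarse_vanishing_transfer (T T' : Type) (near : nat -> T -> T -> Prop)
    (near' : nat -> T' -> T' -> Prop) (V : normedModType R)
    (phi : T -> T') (psi : T' -> T) (k : nat) :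
  (forall r, exists s, forall x y, near r x y -> near' s (phi x) (phi y)) ->
  (forall r, exists s, forall v w, near' r v w -> near s (psi v) (psi w)) ->
  (forall v, near' k v (phi (psi v))) ->
  (forall r s v w, (r <= s)%N -> near' r v w -> near' s v w) ->
  (forall r s u v w, near' r u v -> near' s v w -> near' (r + s) u w) ->
  coarse_vanishing near V -> coarse_vanishing near' V.
Proof.
move=> phiP psiP hk near'W near'_trans van F Fc Fb.
set h := fun v => phi (psi v) in hk.
have [||g gb gE] := van (fun x y z => F (phi x) (phi y) (phi z)).
- by move=> x y z w; exact: Fc.
- move=> r; have [s sP] := phiP r; have [M MP] := Fb s; exists M => x y z xy xz yz.
  by apply: MP; exact: sP.
have /choice [sh shP] : forall r, exists s, forall v w, near' r v w ->
    near' s (h v) (h w).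
  move=> r; have [s sP] := psiP r; have [t tP] := phiP s.
  by exists t => v w vw; exact/tP/sP.
exists (fun v w => g (psi v) (psi w) + (F v w (h w) - F v (h v) (h w))).
  move=> r; have [s sP] := psiP r; have [N gN] := gb s.
  have [M FM] := Fb (r + k + sh r)%N.
  exists (N + (M + M)) => v w vw.
  have le1 : (r <= r + k + sh r)%N by lia.
  have le2 : (k <= r + k + sh r)%N by lia.
  have le3 : (sh r <= r + k + sh r)%N by lia.
  have le4 : (r + k <= r + k + sh r)%N by lia.
  have vhw := near'W _ _ _ _ le4 (near'_trans _ _ _ _ _ vw (hk w)).
  rewrite (le_trans (ler_normD _ _))// lerD ?gN//; first exact: sP.
  rewrite (le_trans (ler_normB _ _))// lerD// FM//.
  - exact: near'W vw.
  - exact: near'W (hk w).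
  - exact: near'W (hk v).
  - exact: near'W (shP _ _ _ vw).
move=> x y z.
(* The prism over the triangle [x, y, z] consists of three tetrahedra; these are their cocycle
   identities. *)
have /eqP := cocycle2E Fc x y z (h z); rewrite subr_eq => /eqP e1.
have /eqP := cocycle2E Fc x y (h y) (h z); rewrite subr_eq => /eqP e2.
have /esym/eqP := cocycle2E Fc x (h x) (h y) (h z); rewrite subr_eq => /eqP e3.
have gE' := gE (psi x) (psi y) (psi z).
rewrite -/(h x) -/(h y) -/(h z) in gE'.
rewrite e1 e2 e3 gE'; zmod_eq.
Qed.

End CoarseCohomology.

(** * Cochains of a graph as functions on tuples of vertices *)

Section GraphCochains.
Variables (R : realType) (Z : graph).
Local Notation T := (vertex Z).

Definition pair_tuple (x y : T) : {ffun 'I_2 -> T} :=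
  [ffun k => if k == ord0 then x else y].
Definition triple_tuple (x y z : T) : {ffun 'I_3 -> T} :=
  [ffun k : 'I_3 => nth x [:: x; y; z] k].
Definition quad_tuple (x y z w : T) : {ffun 'I_4 -> T} :=
  [ffun k : 'I_4 => nth x [:: x; y; z; w] k].

Lemma boundary_linear i : linear (@boundary R Z i).
Proof. exact: lext_linear. Qed.

Lemma boundary_basis i (t : {ffun 'I_i.+2 -> T}) :
  boundary (<< t >> : chain R Z i.+1) =
  \sum_(j < i.+2) (-1) ^+ j *: (<< face j t >> : chain R Z i).
Proof. exact: lextU. Qed.

Lemma alternating_sum3 (V : lmodType R) (G : 'I_3 -> V) :
  \sum_(j < 3) (-1) ^+ j *: G j = G (inord 0) - G (inord 1) + G (inord 2).
Proof.
rewrite !big_ord_recl big_ord0 addr0 addrA expr0 expr1 sqrrN expr1n !scale1r scaleN1r.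
by congr (G _ - G _ + G _); apply: val_inj; rewrite /= inordK.
Qed.

Lemma alternating_sum4 (V : lmodType R) (G : 'I_4 -> V) :
  \sum_(j < 4) (-1) ^+ j *: G j =
  G (inord 0) - G (inord 1) + G (inord 2) - G (inord 3).
Proof.
rewrite !big_ord_recl big_ord0 addr0 !addrA expr0 expr1 sqrrN expr1n.
rewrite /= /bump/= exprSr sqrrN expr1n mul1r !scale1r !scaleN1r.
by congr (G _ - G _ + G _ - G _); apply: val_inj; rewrite /= inordK.
Qed.

Lemma face_triple x y z :
  [/\ face (inord 0) (triple_tuple x y z) = pair_tuple y z,
      face (inord 1) (triple_tuple x y z) = pair_tuple x z &
      face (inord 2) (triple_tuple x y z) = pair_tuple x y].
Proof.
by split; apply/ffunP => -[[|[|//]] ?]; rewrite !ffunE /= /bump inordK.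
Qed.

Lemma face_quad x y z w :
  [/\ face (inord 0) (quad_tuple x y z w) = triple_tuple y z w,
      face (inord 1) (quad_tuple x y z w) = triple_tuple x z w,
      face (inord 2) (quad_tuple x y z w) = triple_tuple x y w &
      face (inord 3) (quad_tuple x y z w) = triple_tuple x y z].
Proof.
by split; apply/ffunP => -[[|[|[|//]]] ?]; rewrite !ffunE /= /bump inordK.
Qed.

Lemma boundary_triple x y z :
  boundary (<< triple_tuple x y z >> : chain R Z 2) =
  << pair_tuple y z >> - << pair_tuple x z >> + << pair_tuple x y >>.
Proof.
by rewrite boundary_basis alternating_sum3; have [-> -> ->] := face_triple x y z.
Qed.

Lemma boundary_quad x y z w :
  boundary (<< quad_tuple x y z w >> : chain R Z 3) =
  << triple_tuple y z w >> - << triple_tuple x z w >>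
  + << triple_tuple x y w >> - << triple_tuple x y z >>.
Proof.
by rewrite boundary_basis alternating_sum4; have [-> -> -> ->] := face_quad x y z w.
Qed.

Lemma pair_tupleE (t : {ffun 'I_2 -> T}) : t = pair_tuple (t 0) (t 1).
Proof.
apply/ffunP => -[[|[|]]]//= k; rewrite !ffunE/=; congr (t _); exact: val_inj.
Qed.

Lemma triple_tupleE (t : {ffun 'I_3 -> T}) :
  t = triple_tuple (t 0) (t 1) (t (inord 2)).
Proof.
apply/ffunP => -[[|[|[|]]]]//= k; rewrite !ffunE/=; congr (t _);
  by apply: val_inj; rewrite /= ?inordK.
Qed.

Lemma quad_tupleE (t : {ffun 'I_4 -> T}) :
  t = quad_tuple (t 0) (t 1) (t (inord 2)) (t (inord 3)).
Proof.
apply/ffunP => -[[|[|[|[|]]]]]//= k; rewrite !ffunE/=; congr (t _);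
  by apply: val_inj; rewrite /= ?inordK.
Qed.

Lemma small_pairP r x y :
  small_tuple R r (pair_tuple x y) <-> near_vertices r x y.
Proof.
split=> [/(_ 0 1)|xy]; first by rewrite !ffunE/= vdist_leP.
have n0 v : near_vertices r v v by exact: near_verticesW (near_verticesxx v).
by move=> [[|[|]]]//= ? [[|[|]]]//= ?; rewrite !ffunE/= vdist_leP//;
  exact: near_verticesC.
Qed.

Lemma small_tripleP r x y z :
  small_tuple R r (triple_tuple x y z) <->
  [/\ near_vertices r x y, near_vertices r x z & near_vertices r y z].
Proof.
split=> [h|[xy xz yz]].
  by split; [move: (h 0 1)|move: (h 0 (inord 2))|move: (h 1 (inord 2))];
    rewrite !ffunE/= ?inordK// vdist_leP.
have n0 v : near_vertices r v v by exact: near_verticesW (near_verticesxx v).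
by move=> [[|[|[|]]]]//= ? [[|[|[|]]]]//= ?; rewrite !ffunE/= vdist_leP//;
  exact: near_verticesC.
Qed.

Lemma small_chainU r i (t : {ffun 'I_i.+1 -> T}) :
  small_tuple R r t -> small_chain r (<< t >> : chain R Z i).
Proof. by move=> tr x; rewrite msuppU oner_eq0 inE => /eqP ->. Qed.

Lemma linear_chain_ext (V : normedModType R) i (f g : chain R Z i -> V) :
  linear f -> linear g -> (forall t, f << t >> = g << t >>) -> f = g.
Proof.
move=> fl gl fg; apply/funext => c.
rewrite (linear_lextE fl) (linear_lextE gl) /lext.
by apply: eq_bigr => t _; rewrite fg.
Qed.

Lemma coboundary_linear (V : normedModType R) i (f : chain R Z i -> V) :
  linear f -> linear (coboundary f).
Proof. by move=> fl t c d; rewrite /coboundary/= boundary_linear fl. Qed.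

Lemma linear_fun (U V : lmodType R) (f : U -> V) : linear f ->
  exists F : {linear U -> V}, f = F.
Proof.
move=> fl.
pose F : {linear U -> V} := HB.pack f (GRing.isLinear.Build _ _ _ _ f fl).
by exists F.
Qed.

Lemma cst0_linear (U V : lmodType R) : linear (cst 0 : U -> V).
Proof. by move=> a u v; rewrite /= scaler0 addr0. Qed.

Lemma coboundary_triple (V : normedModType R) (f : chain R Z 1 -> V) x y z :
  linear f -> coboundary f << triple_tuple x y z >> =
  f << pair_tuple y z >> - f << pair_tuple x z >> + f << pair_tuple x y >>.
Proof.
move=> /linear_fun[F ->].
by rewrite /coboundary/= boundary_triple linearD linearB.
Qed.

Lemma coboundary_quad (V : normedModType R) (f : chain R Z 2 -> V) x y z w :
  linear f -> coboundary f << quad_tuple x y z w >> =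
  f << triple_tuple y z w >> - f << triple_tuple x z w >>
  + f << triple_tuple x y w >> - f << triple_tuple x y z >>.
Proof.
move=> /linear_fun[F ->].
by rewrite /coboundary/= boundary_quad linearB linearD linearB.
Qed.

Lemma l1normU i (t : {ffun 'I_i.+1 -> T}) : l1norm (<< t >> : chain R Z i) = 1.
Proof. exact: l1U. Qed.

(** Linear extension and restriction to basis tuples are inverse to each other, and a bound on the
    small basis tuples is the same as a bound for the l1 norm on small chains. *)
Lemma graph_cohomology_coarse (V : normedModType R) :
  graph_cohomology_vanishes Z V 2 <-> coarse_vanishing (@near_vertices Z) V.
Proof.
split=> [van F Fc Fb|van f [[fl fb] fc]].
  pose a (t : {ffun 'I_3 -> T}) := F (t 0) (t 1) (t (inord 2)).
  have aE x y z : a (triple_tuple x y z) = F x y z.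
    by rewrite /a !ffunE/= inordK.
  pose f : chain R Z 2 -> V := lext a.
  have fl : linear f by exact: lext_linear.
  have fE x y z : f << triple_tuple x y z >> = F x y z by rewrite /f lextU aE.
  have fcocycle : cocycles f.
    split; first split => //.
      move=> r; have [M FM] := Fb r; exists M => c cr.
      apply: ler_norm_lext => t /cr; rewrite [t]triple_tupleE aE.
      by move=> /small_tripleP[? ? ?]; exact: FM.
    apply: linear_chain_ext => [||t]; first exact: coboundary_linear.
      exact: cst0_linear.
    by rewrite [t]quad_tupleE coboundary_quad// !fE Fc.
  have [g [gl gb] gE] := van _ fcocycle.
  exists (fun x y => g << pair_tuple x y >>).
    move=> r; have [M gM] := gb r; exists M => x y xy.
    by rewrite (le_trans (gM _ (small_chainU _)))// ?l1normU ?mulr1//;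
      exact/small_pairP.
  by move=> x y z; rewrite -fE -gE coboundary_triple.
pose F x y z := f << triple_tuple x y z >>.
have [||g gb gE] := van F.
- move=> x y z w; rewrite /F -coboundary_quad// fc//.
- move=> r; have [M fM] := fb r; exists M => x y z xy xz yz.
  by rewrite (le_trans (fM _ (small_chainU _)))// ?l1normU ?mulr1//;
    exact/small_tripleP.
pose b (t : {ffun 'I_2 -> T}) := g (t 0) (t 1).
pose G : chain R Z 1 -> V := lext b.
have Gl : linear G by exact: lext_linear.
have GE x y : G << pair_tuple x y >> = g x y by rewrite /G lextU /b !ffunE.
exists G; first split => //.
  move=> r; have [M gM] := gb r; exists M => c cr.
  apply: ler_norm_lext => t /cr; rewrite [t]pair_tupleE => /small_pairP.
  by move=> /gM; rewrite /b !ffunE.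
apply: linear_chain_ext => [|//|t]; first exact: coboundary_linear.
by rewrite [t]triple_tupleE coboundary_triple// !GE -gE.
Qed.

End GraphCochains.

(** * Quasi-isometries *)

Section PointDistance.
Variables (R : realType) (Z : graph).
Implicit Types (p q : cw_point R Z) (n : nat).

Definition cw_base p : vertex Z :=
  match p with Vertex v => v | Inner e _ _ => end_vertex e false end.

Lemma exits_near p a : exits p a ->
  [/\ 0 <= a.2, a.2 <= 1 & near_vertices 1 (cw_base p) a.1].
Proof.
case: p => [v ->|e t /= /andP[t0 t1] [|] ->] /=.
- by split => //; exact: near_verticesW (near_verticesxx v).
- by split; [exact: ltW|exact: ltW|exact: near_vertices_edge].
- by split; [lra|lra|exact: near_vertices_edge].
Qed.

Lemma exits_base p : exists t, exits p (cw_base p, t).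
Proof. by case: p => [v|e t te]; [exists 0|exists t; left]. Qed.

(** The 2 pays for the ways from [p] and [q] to their base vertices, each of length at most 1. *)
Lemma near_point_dist n p q : near_vertices n (cw_base p) (cw_base q) ->
  (point_dist p q <= (n + 2)%:R%:E)%E.
Proof.
move=> /(vdist_leP R) pq.
have [s ps] := exits_base p; have [t qt] := exits_base q.
have [/= s0 s1 _] := exits_near ps; have [/= t0 t1 _] := exits_near qt.
apply: ereal_inf_le; eexists.
  by left; exists (cw_base p, s) => //; exists (cw_base q, t).
have -> : (n + 2)%:R = 1 + n%:R + 1 :> R by rewrite natrD; lra.
rewrite !EFinD.
by apply: leeD; rewrite ?lee_fin//; apply: leeD; rewrite ?lee_fin.
Qed.

(** A way from [p] to [q] passes through ends of their cells, each at most one step from the base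
    vertex. If it stays inside one edge, the base vertices coincide. *)
Lemma point_dist_near n p q : (point_dist p q < n%:R%:E)%E ->
  near_vertices (n + 2) (cw_base p) (cw_base q).
Proof.
move=> /ereal_inf_lt[_ [[a pa [b qb <-]]|[r pqr <-]] pqn]; last first.
  case: p q pqr {pqn} => [//|e s se] [//|e' t te] [<- _] /=.
  exact: near_verticesW (near_verticesxx _).
have [a0 _ pa1] := exits_near pa; have [b0 _ qb1] := exits_near qb.
suff : near_vertices n a.1 b.1.
  move=> ab.
  have := near_vertices_trans (near_vertices_trans pa1 ab) (near_verticesC qb1).
  by apply: near_verticesW; lia.
apply/(vdist_leP R)/ltW; apply: le_lt_trans pqn.
rewrite -addeA addeC -addeA leeDl//.
by rewrite -EFinD lee_fin addr_ge0.
Qed.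

End PointDistance.

Section QuasiIsometry.
Variables (R : realType).

Lemma exists_nat_gt (a : R) : exists n, a < n%:R.
Proof. by exists (Num.truncn a).+1; exact: truncnS_gt. Qed.

Definition near_points (X : metricType R) (r : nat) (x y : X) : Prop :=
  mdist x y <= r%:R.

(** [phi] rounds the quasi-isometry to vertices, and [psi] picks for each vertex a point whose image
    is close to it. *)
Lemma quasi_isometric_coarse (X : metricType R) (Z : graph) :
  quasi_isometric X Z ->
  exists (phi : X -> vertex Z) (psi : vertex Z -> X) (k : nat),
    [/\ forall r, exists s, forall x y,
          near_points r x y -> near_vertices s (phi x) (phi y),
        forall r, exists s, forall v w,
          near_vertices r v w -> near_points s (psi v) (psi w),
        forall x, near_points k x (psi (phi x)) &
        forall v, near_vertices k v (phi (psi v))].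
Proof.
move=> [f [L [C [L1 C0 fLC fC]]]].
have L0 : 0 < L by lra.
have [psi psiC] := choice (fun v => fC (Vertex R v)).
have [c Cc] := exists_nat_gt C.
have psi_near v : near_vertices (c + 2) (cw_base (f (psi v))) v.
  apply: (@point_dist_near R Z c (f (psi v)) (Vertex R v)).
  by apply: le_lt_trans (psiC v) _; rewrite lte_fin.
have dist_le n x y : near_vertices n (cw_base (f x)) (cw_base (f y)) ->
    mdist x y <= L * ((n + 2)%:R + C).
  move=> /near_point_dist xy; have /andP[+ _] := fLC x y.
  move=> /le_trans/(_ xy); rewrite lee_fin lerBlDr => h.
  by rewrite -ler_pdivrMl.
have [k kP] := exists_nat_gt (L * ((c + 2 + 2)%:R + C)).
exists (fun x => cw_base (f x)), psi, (maxn k (c + 2)); split => /=.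
- move=> r; have [n nP] := exists_nat_gt (L * r%:R + C).
  exists (n + 2)%N => x y xy; apply: point_dist_near.
  have /andP[_ +] := fLC x y => /le_lt_trans; apply.
  by rewrite lte_fin (le_lt_trans _ nP)// lerD2r ler_pM2l.
- move=> r; have [n nP] := exists_nat_gt (L * ((c + 2 + r + (c + 2) + 2)%:R + C)).
  exists n => v w vw; apply: ltW; apply: le_lt_trans nP; apply: dist_le.
  apply: near_vertices_trans (near_verticesC (psi_near w)).
  exact: near_vertices_trans vw.
- move=> x; rewrite /near_points natr_max le_max; apply/orP; left.
  apply: ltW; apply: le_lt_trans kP; apply: dist_le.
  exact: near_verticesC (psi_near _).
- move=> v; apply: near_verticesW (near_verticesC (psi_near v)).
  exact: leq_maxr.
Qed.

(** Tests the cohomology on the points of [X], which makes it independent of the graph. *)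
Lemma coarse_vanishing_quasi_isometric (X : metricType R) (Z : graph)
    (V : normedModType R) : quasi_isometric X Z ->
  coarse_vanishing (@near_points X) V <-> graph_cohomology_vanishes Z V 2.
Proof.
move=> /quasi_isometric_coarse[phi [psi [k [phiP psiP Xk Zk]]]].
rewrite graph_cohomology_coarse; split.
  apply: (coarse_vanishing_transfer phiP psiP Zk).
    by move=> r s v w; exact: near_verticesW.
  by move=> r s u v w; exact: near_vertices_trans.
apply: (coarse_vanishing_transfer psiP phiP Xk).
  by move=> r s x y rs xy; apply: le_trans xy _; rewrite ler_nat.
move=> r s x y z xy yz; rewrite /near_points natrD.
by apply: le_trans (metric_triangle _ _ _) (lerD xy yz).
Qed.

End QuasiIsometry.

(** * The Rips graph at scale 1 *)

Section UnitGraph.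
Variables (R : realType) (X : metricType R).
Implicit Types (x y z : X).

(** Its vertices are all points of [X], so that for a geodesic space nearness in the graph and in
    [X] agree exactly, without any rounding. *)
Definition unit_graph : graph :=
  @Graph X {xy : X * X | mdist xy.1 xy.2 <= 1}
    (fun e b => if b then (val e).2 else (val e).1).

Lemma mdist_edge (a : oriented_edge unit_graph) :
  mdist (edge_tail a : X) (edge_head a) <= 1.
Proof.
by case: a => [[[x y] /= xy] []]; rewrite /edge_tail/edge_head/= // metric_sym.
Qed.

Lemma mdist_path x y (p : seq (oriented_edge unit_graph)) :
  path_from_to (x : vertex unit_graph) p y -> mdist x y <= (size p)%:R.
Proof.
elim: p x => [x /= ->|a p IH x /= [<- /IH h]]; first by rewrite mdistxx.
rewrite -natr1 addrC (le_trans (metric_triangle _ (edge_head a) _))//.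
by rewrite lerD// mdist_edge.
Qed.

Hypothesis geoX : geodesic_space X.

Lemma geodesic_split s t x y : 0 <= s -> 0 <= t -> mdist x y <= s + t ->
  exists2 z, mdist x z <= s & mdist z y <= t.
Proof.
move=> s0 t0 xyst; have [g [g0 gd gP]] := geoX x y.
have d0 := mdist_ge0 x y.
have [sd|ds] := leP s (mdist x y).
  exists (g s).
    by rewrite -{1}g0 gP ?lexx ?s0//; rewrite sub0r normrN ger0_norm.
  rewrite -{1}gd gP ?lexx ?s0 ?d0//.
  by rewrite distrC ger0_norm; lra.
by exists y; [exact: ltW|rewrite mdistxx].
Qed.

(** Unit steps add up by the triangle inequality; conversely a geodesic is cut into [n] pieces of
    length at most 1. *)
Lemma unit_graph_near n x y :
  near_vertices n (x : vertex unit_graph) y <-> near_points n x y.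
Proof.
split=> [[p xp pn]|].
  by apply: le_trans (mdist_path xp) _; rewrite ler_nat.
elim: n x => [x|n IH x].
  rewrite /near_points => xy0.
  have -> : x = y by apply: mdist_positivity; apply/le_anti; rewrite xy0 mdist_ge0.
  exact: near_verticesxx.
rewrite /near_points -natr1 addrC => /geodesic_split[//|//|z xz /IH zy].
apply: (@near_vertices_trans unit_graph 1 n _ z) zy.
by exists [:: (exist (fun xy : X * X => mdist xy.1 xy.2 <= 1) (x, z) xz, false)].
Qed.

Lemma unit_graph_connected : connected_graph unit_graph.
Proof.
move=> x y; have [n /ltW xyn] := exists_nat_gt (mdist (x : X) y).
by have /unit_graph_near[p xp _] := xyn; exists p.
Qed.

Lemma unit_graph_quasi_isometric : quasi_isometric X unit_graph.
Proof.
(* The constant 3 is 1 for rounding the distance up to an integer, plus the 2 of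
   [near_point_dist]. *)
exists (fun x => @Vertex R unit_graph x), 1, 3; split => //.
- move=> x y; rewrite invr1 !mul1r; apply/andP; split.
    apply: le_ereal_inf_tmp => _ [[a -> [b -> <-]]|[r []]] /=.
    rewrite add0e adde0; apply: le_ereal_inf_tmp => _ [p xp <-].
    by rewrite lee_fin lerBlDr (le_trans (mdist_path xp))// lerDl.
  have d0 := mdist_ge0 x y.
  have /andP[nd dn] := truncn_itv d0.
  have /unit_graph_near xyn : near_points (Num.truncn (mdist x y)).+1 x y by exact: ltW.
  have := @near_point_dist R unit_graph _
    (@Vertex R unit_graph x) (@Vertex R unit_graph y) xyn.
  move=> /le_trans; apply; rewrite lee_fin natrD -natr1; lra.
- move=> q; exists (cw_base q).
  apply: le_trans (@near_point_dist _ _ 0 (@Vertex R unit_graph (cw_base q)) q _) _.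
    exact: near_verticesxx.
  by rewrite lee_fin ler_nat.
Qed.

End UnitGraph.

(** * Filling closed paths in hyperbolic spaces *)

Section ShortcutLemma.
Variables (R : realType) (X : metricType R).
Implicit Types (o w x y z : X).

Lemma geodesic_segmentE x y S w : geodesic_segment x y S -> S w ->
  mdist x w + mdist w y = mdist x y.
Proof.
move=> [g [g0 gd gP] ->] [t /= /andP[t0 td] <-].
have d0 := mdist_ge0 x y.
rewrite -{1}g0 -{1}gd !gP ?lexx ?t0 ?d0//.
by rewrite sub0r normrN ger0_norm// distrC ger0_norm ?subr_ge0// addrC subrK.
Qed.

Lemma exists_geodesic_segment : geodesic_space X ->
  forall x y, exists S, geodesic_segment x y S.
Proof. by move=> geoX x y; have [g gP] := geoX x y; eexists; exists g. Qed.

(** As [x] is almost between [y] and [z], slimness of the triangle [y, z, x] puts it within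
    [2 * d + 1] of the point [p] of the geodesic from [y] to [z] that is as far from [y] as [x] is
    (or of [z]). Slimness of the triangle [y, z, o] then gives [w] within [d] of [p]. *)
Lemma hyperbolic_near_sides : geodesic_space X -> hyperbolic X ->
  exists2 D : R, 0 <= D & forall o x y z,
    mdist y x + mdist x z <= mdist y z + 1 ->
    exists2 w, mdist x w <= D &
      mdist o w + mdist w y = mdist o y \/ mdist o w + mdist w z = mdist o z.
Proof.
move=> geoX [d d0 slim]; exists (3 * d + 1); first by lra.
move=> o x y z xyz; have [g [g0 gd gP]] := geoX y z.
have yz0 := mdist_ge0 y z; have yx0 := mdist_ge0 y x.
pose u := Num.min (mdist y x) (mdist y z).
have [u0 ux uz] : [/\ 0 <= u, u <= mdist y x & u <= mdist y z].
  by split; rewrite /u ?ge_min ?le_min ?lexx ?orbT ?yx0.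
pose p := g u.
have yp : mdist y p = u.
  by rewrite -{1}g0 gP ?lexx ?u0// sub0r normrN ger0_norm.
have pz : mdist p z = mdist y z - u.
  by rewrite -{1}gd gP ?lexx ?u0 ?yz0// distrC ger0_norm ?subr_ge0.
pose S1 := g @` [set t | 0 <= t <= mdist y z].
have S1P : geodesic_segment y z S1 by exists g.
have S1p : S1 p by exists u => //=; rewrite u0.
have xp : mdist x p <= 2 * d + 1.
  have [S2 S2P] := exists_geodesic_segment geoX z x.
  have [S3 S3P] := exists_geodesic_segment geoX x y.
  have [uE|uE] : u = mdist y x \/ u = mdist y z.
    by rewrite /u; case: leP; [left|right].
  - have [q S23q pq] := slim _ _ _ _ _ _ S1P S2P S3P _ S1p.
    have tr := metric_triangle x q p; rewrite [mdist q p]metric_sym in tr.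
    case: S23q => [/(geodesic_segmentE S2P)|/(geodesic_segmentE S3P)] e.
      have := metric_triangle z q p.
      rewrite ![mdist z _]metric_sym [mdist q p]metric_sym in e *.
      by rewrite ![mdist q x]metric_sym in e *; lra.
    have := metric_triangle y q p.
    rewrite [mdist y q]metric_sym [mdist q p]metric_sym.
    by rewrite [mdist x y]metric_sym in e; lra.
  - have -> : p = z by rewrite /p uE.
    by lra.
have [S2 S2P] := exists_geodesic_segment geoX z o.
have [S3 S3P] := exists_geodesic_segment geoX o y.
have [w S23w pw] := slim _ _ _ _ _ _ S1P S2P S3P _ S1p.
exists w.
  by have := metric_triangle x p w; lra.
case: S23w => [/(geodesic_segmentE S2P)|/(geodesic_segmentE S3P)] e; [right|left].
  by rewrite [mdist o w]metric_sym [mdist w z]metric_sym [mdist o z]metric_sym addrC.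
exact: e.
Qed.

(** Otherwise [x] is almost between [y] and [z] and more than [m - 1] away from both. If the point
    [w] near [x] lies between [o] and [y], say, then [mdist o y] exceeds
    [mdist o x + m - 1 - 2 * D], which is larger than [mdist o x]. *)
Lemma hyperbolic_shortcut : geodesic_space X -> hyperbolic X ->
  exists2 m : nat, (0 < m)%N & forall o x y z,
    mdist y x <= m%:R -> mdist x z <= m%:R ->
    mdist o y <= mdist o x -> mdist o z <= mdist o x ->
    mdist y z <= (2 * m).-1%:R.
Proof.
move=> geoX /(hyperbolic_near_sides geoX)[D D0 hD].
have [m mP] := exists_nat_gt (2 * D + 1).
have m0 : (0 < m)%N by rewrite -(ltr_nat R) mulr0n; lra.
exists m => // o x y z yx xz oy oz.
have -> : (2 * m).-1%:R = 2 * m%:R - 1 :> R.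
  by rewrite -subn1 natrB ?muln_gt0// natrM.
rewrite leNgt; apply/negP => yz.
have [|w xw] := hD o x y z; first by lra.
have xyz := metric_triangle y x z.
have oxw := metric_triangle o w x; rewrite [mdist w x]metric_sym in oxw.
move=> [e|e].
  have := metric_triangle y w x.
  by rewrite [mdist y w]metric_sym [mdist w x]metric_sym; lra.
have := metric_triangle x w z; lra.
Qed.

End ShortcutLemma.

Section Filling.
Variables (R : realType) (X : metricType R).
Hypothesis geoX : geodesic_space X.
Local Notation Z := (unit_graph X).
Local Notation E x y := (<< @pair_tuple Z x y >> : chain R Z 1).

(** Discrete paths are sequences on all of [nat] with a separate length, so that they can be shifted
    and cut freely. *)
Definition unit_steps (t : nat -> X) : Prop := forall i, mdist (t i) (t i.+1) <= 1.

Definition steps_sum (V : nmodType) (a : X -> X -> V) (t : nat -> X) (n : nat) : V :=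
  \sum_(i < n) a (t i) (t i.+1).

Local Notation steps_chain := (steps_sum (fun x y => E x y)).

Lemma eq_steps_sum (V : nmodType) (a : X -> X -> V) t u n :
  (forall i, (i <= n)%N -> t i = u i) -> steps_sum a t n = steps_sum a u n.
Proof. by move=> tu; apply: eq_bigr => i _; rewrite !tu// ltnW. Qed.

Lemma steps_sumD (V : nmodType) (a : X -> X -> V) t m n :
  steps_sum a t (m + n) = steps_sum a t m + steps_sum a (fun i => t (m + i)%N) n.
Proof.
rewrite [LHS]big_split_ord/=; congr (_ + _).
by apply: eq_bigr => i _; rewrite addnS.
Qed.

Lemma steps_sumS (V : nmodType) (a : X -> X -> V) t n :
  steps_sum a t n.+1 = a (t 0) (t 1) + steps_sum a (fun i => t i.+1) n.
Proof. exact: big_ord_recl. Qed.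

Definition concat_steps (t : nat -> X) (n : nat) (s : nat -> X) (i : nat) : X :=
  if (i < n)%N then t i else s (i - n)%N.

Lemma concat_stepsP t n s : unit_steps t -> unit_steps s -> t n = s 0 ->
  [/\ unit_steps (concat_steps t n s),
      concat_steps t n s 0 = t 0,
      forall k, concat_steps t n s (n + k) = s k &
      forall (V : nmodType) (a : X -> X -> V) k,
        steps_sum a (concat_steps t n s) (n + k) = steps_sum a t n + steps_sum a s k].
Proof.
move=> t1 s1 ts.
have le_t i : (i <= n)%N -> concat_steps t n s i = t i.
  rewrite /concat_steps leq_eqVlt => /predU1P[->|->//].
  by rewrite ltnn subnn ts.
have ge_s i : concat_steps t n s (n + i) = s i.
  by rewrite /concat_steps ltnNge leq_addr/= addKn.
split => //.
- move=> i; have [lt_in|le_ni] := ltnP i n; first by rewrite !le_t// ltnW.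
  by rewrite -(subnKC le_ni) -addnS !ge_s; exact: s1.
- exact: le_t.
- move=> V a k; rewrite steps_sumD (eq_steps_sum _ le_t); congr (_ + _).
  by apply: eq_steps_sum => i _; exact: ge_s.
Qed.

(** An actual chain witnesses the bound, in place of the infimum in [filling_norm]. *)
Definition fillable (r : nat) (N : R) (b : chain R Z 1) : Prop :=
  exists c : chain R Z 2, [/\ small_chain r c, boundary c = b & l1norm c <= N].

Lemma fillable0 r : fillable r 0 0.
Proof.
exists 0; split; first by move=> x; rewrite msupp0.
  by have [F ->] := linear_fun (@boundary_linear R Z 1); rewrite linear0.
by rewrite /l1norm msupp0 big_seq_fset0.
Qed.

Lemma fillableD r N N' b b' :
  fillable r N b -> fillable r N' b' -> fillable r (N + N') (b + b').
Proof.
move=> [c [cr <- cN]] [c' [c'r <- c'N]]; exists (c + c'); split.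
- move=> x /(fsubsetP (msuppD_le _ _)); rewrite in_fsetU => /orP[/cr|/c'r]//.
- by have [F ->] := linear_fun (@boundary_linear R Z 1); rewrite linearD.
- by apply: le_trans (l1D _ _) _; exact: lerD.
Qed.

Lemma fillableN r N b : fillable r N b -> fillable r N (- b).
Proof.
move=> [c [cr <- cN]]; exists (- c); split.
- by move=> x; rewrite msuppN => /cr.
- by have [F ->] := linear_fun (@boundary_linear R Z 1); rewrite linearN.
- by rewrite [l1norm _]l1N.
Qed.

Lemma fillable_le r N N' b : N <= N' -> fillable r N b -> fillable r N' b.
Proof. by move=> NN' [c [cr cb cN]]; exists c; split => //; exact: le_trans NN'. Qed.

Lemma mdist_steps t i : unit_steps t -> mdist (t 0) (t i) <= i%:R.
Proof.
move=> t1; elim: i => [|i IH]; first by rewrite mdistxx.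
by rewrite -natr1 (le_trans (metric_triangle _ (t i) _))// lerD.
Qed.

(** One triangle with apex [o] for every step. For a closed path the two end terms cancel. *)
Lemma fillable_cone r t n o : (0 < r)%N -> unit_steps t ->
  (forall i, (i <= n)%N -> mdist o (t i) <= r%:R) ->
  fillable r n%:R (steps_chain t n + E o (t 0) - E o (t n)).
Proof.
move=> r0 t1; elim: n => [_|n IH ot].
  by rewrite /steps_sum big_ord0 add0r subrr; exact: fillable0.
have {}IH := IH (fun i h => ot i (leqW h)).
have tr : fillable r 1 (E (t n) (t n.+1) - E o (t n.+1) + E o (t n)).
  exists << @triple_tuple Z o (t n) (t n.+1) >>; split.
  - apply: small_chainU; apply/small_tripleP; split.
    + by apply/(unit_graph_near geoX)/ot.
    + by apply/(unit_graph_near geoX)/ot.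
    + apply/(unit_graph_near geoX).
      by apply: le_trans (t1 n) _; rewrite ler1n.
  - exact: boundary_triple.
  - by rewrite l1normU.
have := fillableD IH tr; rewrite natr1.
have -> // : steps_chain t n + E o (t 0) - E o (t n)
    + (E (t n) (t n.+1) - E o (t n.+1) + E o (t n))
  = steps_chain t n.+1 + E o (t 0) - E o (t n.+1).
rewrite [steps_chain t n.+1]big_ord_recr/= -/(steps_chain t n).
move: (steps_chain t n) (E o _) (E o _) (E o _) (E (t n) _) => a b c d e.
by zmod_eq.
Qed.

Lemma sum_periodic (V : zmodType) (a : nat -> V) n k :
  (forall i, a (i + n)%N = a i) -> \sum_(i < n) a (i + k)%N = \sum_(i < n) a i.
Proof.
move=> an; elim: k => [|k IH]; first by apply: eq_bigr => i _; rewrite addn0.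
rewrite -[RHS]IH; apply: (addrI (a k)).
transitivity (\sum_(i < n.+1) a (i + k)%N).
  rewrite big_ord_recl/= add0n; congr (_ + _); apply: eq_bigr => i _.
  by rewrite /= /bump/= addnS addSn.
by rewrite big_ord_recr/= addnC an addrC.
Qed.

Lemma exists_unit_steps n x y : near_points n x y ->
  exists t : nat -> X, [/\ unit_steps t, t 0 = x & t n = y].
Proof.
elim: n x => [x xy0|n IH x].
  exists (fun=> x); split => //; first by move=> i; rewrite mdistxx.
  by apply: mdist_positivity; apply/le_anti; rewrite mdist_ge0 andbT.
rewrite /near_points -natr1 addrC => /(geodesic_split geoX)[//|//|z xz].
move=> /IH[t [t1 t0 tn]]; exists (fun i => if i is j.+1 then t j else x).
by split => // -[|i]/=; [rewrite t0|exact: t1].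
Qed.

(** Induction on the length. A loop shorter than [2 * m] is coned off from its starting point. In a
    longer one, [2 * m] steps around a point farthest from [t 0] are replaced by one step fewer; two
    cones with at most [4 * m] triangles in all fill the difference. *)
Lemma hyperbolic_fillable : hyperbolic X ->
  exists r (C : nat), (0 < r)%N /\ forall t n, unit_steps t -> t n = t 0 ->
    fillable r (C * n)%:R (steps_chain t n).
Proof.
move=> /(hyperbolic_shortcut geoX)[m m0 short].
exists (2 * m)%N, (4 * m)%N; split; first by rewrite muln_gt0.
move=> t n; elim: n t => [|N IH] t t1 tn.
  by rewrite muln0 /steps_sum big_ord0; exact: fillable0.
have [nm|mn] := ltnP N.+1 (2 * m).
  apply: (@fillable_le _ N.+1%:R); first by rewrite ler_nat leq_pmull ?muln_gt0.
  have := @fillable_cone (2 * m) t N.+1 (t 0) _ t1 _.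
  rewrite tn addrK; apply; first by rewrite muln_gt0.
  move=> i iN; apply: le_trans (mdist_steps i t1) _.
  by rewrite ler_nat; apply: leq_trans iN (ltnW nm).
pose n := N.+1.
(* Periodic extension, so that the stretch may run across the starting point. *)
pose x i := t (i %% n)%N.
have x_per i : x (i + n)%N = x i by rewrite /x modnDr.
have x1 : unit_steps x.
  move=> i; rewrite /x; have := ltn_pmod i (ltn0Sn N); rewrite -/n => lt_in.
  have [lt_in1|] := ltnP (i %% n).+1 n.
    have -> : (i.+1 %% n = (i %% n).+1)%N.
      by rewrite -[in LHS]addn1 -modnDml addn1 modn_small.
    exact: t1.
  move=> ge_in; have e : (i %% n).+1 = n by apply/eqP; rewrite eqn_leq lt_in.
  have -> : (i.+1 %% n = 0)%N by rewrite -[i.+1]addn1 -modnDml addn1 e modnn.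
  by rewrite -tn -/n -{2}e; exact: t1.
have xt : steps_chain x n = steps_chain t n.
  apply: eq_bigr => i _; rewrite /x modn_small//.
  have [lt_in1|ge_in] := ltnP i.+1 n; first by rewrite modn_small.
  have -> : i.+1 = n by apply/eqP; rewrite eqn_leq ltn_ord.
  by rewrite modnn tn.
have [k0 k0P] : exists k, forall i, mdist (t 0) (x i) <= mdist (t 0) (x k).
  pose j := [arg max_(j > (ord0 : 'I_n)) mdist (t 0) (x j)]%O.
  exists j => i; rewrite /j; case: arg_maxP => // l _ /(_ (inord (i %% n)) isT).
  rewrite inordK ?ltn_pmod//.
  have -> // : x (i %% n)%N = x i by rewrite /x modn_mod.
have [k kP] : exists k, forall i, mdist (t 0) (x i) <= mdist (t 0) (x (k + m)%N).
  (* This stands for [k0 - m] modulo [n]: the farthest point becomes [y m], the middle of the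
     stretch from [y 0] to [y (2 * m)]. *)
  exists (k0 + m * N)%N => i; rewrite -addnA -mulnSr.
  have -> : x (k0 + m * n)%N = x k0 by rewrite /x addnC modnMDl.
  exact: k0P.
pose y i := x (i + k)%N.
have y1 : unit_steps y by move=> i; rewrite /y addSn; exact: x1.
have yn : y n = y 0 by rewrite /y addnC x_per add0n.
have yt : steps_chain y n = steps_chain t n.
  rewrite -xt /steps_sum.
  rewrite -(@sum_periodic _ (fun i => E (x i) (x i.+1)) n k)//.
  by move=> i; rewrite -addSn !x_per.
have [s [s1 s0 sm]] : exists s : nat -> X,
    [/\ unit_steps s, s 0 = y 0 & s (2 * m).-1 = y (2 * m)%N].
  apply: exists_unit_steps; apply: (short (t 0) (y m)).
  - exact: mdist_steps.
  - rewrite mul2n -addnn.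
    have := @mdist_steps (fun i => y (m + i)%N) m; rewrite addn0; apply.
    by move=> i; rewrite addnS; exact: y1.
  - by rewrite /y [(m + k)%N]addnC; exact: kP.
  - by rewrite /y [(m + k)%N]addnC; exact: kP.
pose M := (2 * m).-1.
have m2 : (2 * m)%N = M.+1 by rewrite prednK// muln_gt0.
pose q := (N - M)%N.
have NE : N = (M + q)%N by rewrite subnKC// -ltnS -m2.
have nE : n = (2 * m + q)%N by rewrite /n NE m2.
have y1' : unit_steps (fun i => y (2 * m + i)%N).
  by move=> i; rewrite addnS; exact: y1.
have [|t'1 t'0 t'q t'E] := concat_stepsP s1 y1' (_ : s M = y (2 * m + 0)%N).
  by rewrite addn0.
have fill' : fillable (2 * m) (4 * m * N)%:R
    (steps_chain s M + steps_chain (fun i => y (2 * m + i)%N) q).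
  by rewrite -t'E -NE; apply: IH => //; rewrite NE t'q t'0 -nE yn s0.
rewrite -yt.
have yE := steps_sumD (fun x y => E x y) y (2 * m) q.
rewrite -nE in yE.
(* The cones over the stretch and over its shortcut share the apex [y 0] and the end points, so the
   edges at the apex cancel in their difference. *)
have fy : fillable (2 * m) (2 * m)%:R
    (steps_chain y (2 * m) + E (y 0) (y 0) - E (y 0) (y (2 * m)%N)).
  apply: fillable_cone => //; first by rewrite muln_gt0.
  by move=> i im; apply: le_trans (mdist_steps i y1) _; rewrite ler_nat.
have fs : fillable (2 * m) M%:R
    (steps_chain s M + E (s 0) (s 0) - E (s 0) (s M)).
  apply: fillable_cone => //; first by rewrite muln_gt0.
  move=> i im; apply: le_trans (mdist_steps i s1) _; rewrite ler_nat.
  by apply: leq_trans im _; rewrite leq_pred.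
have := fillableD fill' (fillableD fy (fillableN fs)).
rewrite -!natrD => /(@fillable_le _ _ (4 * m * N.+1)%:R).
rewrite ler_nat s0 sm => /(_ _).
have -> : steps_chain s M + steps_chain (fun i => y (2 * m + i)%N) q
    + (steps_chain y (2 * m) + E (y 0) (y 0)
    - E (y 0) (y (2 * m)%N) - (steps_chain s M + E (y 0) (y 0)
    - E (y 0) (y (2 * m)%N))) = steps_chain y n.
  rewrite yE.
  move: (steps_chain y _) (steps_chain s _) (E (y 0) (y 0)) (E (y 0) _).
  by move: (steps_chain _ q) => a b c d e; zmod_eq.
apply; rewrite mulnS addnC leq_add2r /M.
lia.
Qed.

Lemma path_chain_steps x y (p : seq (oriented_edge Z)) :
  path_from_to (x : vertex Z) p y ->
  exists t : nat -> X, [/\ unit_steps t, t 0 = x, t (size p) = y &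
    path_chain R p = steps_chain t (size p)].
Proof.
elim: p x => [x /= <-|a p IH x /= [<- /IH[t [t1 t0 tp pE]]]].
  exists (fun=> x); split => //; first by move=> i; rewrite mdistxx.
  by rewrite /path_chain big_nil /steps_sum big_ord0.
exists (fun i => if i is j.+1 then t j else edge_tail a); split => //.
  by move=> [|i] /=; [rewrite t0; exact: mdist_edge|exact: t1].
by rewrite steps_sumS/= t0 -pE [LHS]big_cons.
Qed.

Lemma hyperbolic_finite_isoperimetric : hyperbolic X -> finite_isoperimetric X.
Proof.
move=> /hyperbolic_fillable[r [C [r0 fill]]].
exists Z; split; first exact: unit_graph_quasi_isometric.
exists r, (fun n => (C * n)%:R); split => // p [x /path_chain_steps].
move=> [t [t1 t0 tp ->]].
have [|c [cr cb cN]] := fill t (size p) t1; first by rewrite t0.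
split; first by exists c.
apply: le_trans cN; apply: ge_inf; last by exists c.
by exists 0 => _ [c' _ <-]; exact: l1_ge0.
Qed.

End Filling.

(** * Vanishing of the cohomology of hyperbolic spaces *)

Section Vanishing.
Variables (R : realType) (X : metricType R).
Hypothesis geoX : geodesic_space X.
Implicit Types (x y z o : X) (t s : nat -> X).

Definition edge_steps x y (i : nat) : X := if i is 0 then x else y.

Lemma edge_stepsP x y : near_points 1 x y -> unit_steps (edge_steps x y).
Proof. by move=> xy [|i] /=; rewrite ?mdistxx. Qed.

Lemma exists_steps x y : exists t n, [/\ unit_steps t, t 0 = x & t n = y].
Proof.
have [n /ltW xyn] := exists_nat_gt (mdist x y).
by have [t tP] := exists_unit_steps geoX xyn; exists t, n.
Qed.

(** As [F o] is a primitive of [F], its sum over a closed path is the value of [F] on a filling,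
    whose size is linear in [n]. The constant does not depend on [o]. *)
Lemma hyperbolic_cocycle_sum (V : normedModType R) (F : X -> X -> X -> V) :
  hyperbolic X -> cocycle2 F ->
  (forall r, exists M : R, forall x y z,
    near_points r x y -> near_points r x z -> near_points r y z ->
    `|F x y z| <= M) ->
  exists2 K : R, 0 <= K & forall o t n, unit_steps t -> t n = t 0 ->
    `|steps_sum (F o) t n| <= K * n%:R.
Proof.
move=> /(hyperbolic_fillable geoX)[r [C [r0 fill]]] Fc Fb.
have [M FM] := Fb r; exists (`|M| * C%:R); first exact: mulr_ge0.
move=> o t n t1 tn; have [c [cr cb cN]] := fill t n t1 tn.
pose a (u : {ffun 'I_2 -> X}) := F o (u 0) (u 1).
pose b (u : {ffun 'I_3 -> X}) := F (u 0) (u 1) (u (inord 2)).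
have -> : steps_sum (F o) t n = lext b c.
  have -> : lext b c = coboundary (lext a : chain R (unit_graph X) 1 -> V) c.
    apply: (congr1 (fun f => f c)); apply: linear_chain_ext => [||u].
    - exact: lext_linear.
    - exact/coboundary_linear/lext_linear.
    - rewrite [u](@triple_tupleE (unit_graph X)).
      rewrite coboundary_triple; last exact: lext_linear.
      rewrite !lextU /a /b !ffunE/= inordK//=.
      exact: cocycle2_primitive.
  rewrite /coboundary/= cb /steps_sum raddf_sum; apply: eq_bigr => i _ /=.
  by rewrite lextU /a !ffunE.
have bM : `|lext b c| <= `|M| * l1 c.
  apply: ler_norm_lext => u /cr; rewrite [u](@triple_tupleE (unit_graph X)).
  move=> /small_tripleP[/(unit_graph_near geoX) ? /(unit_graph_near geoX) ?].
  move=> /(unit_graph_near geoX) ?; rewrite /b !ffunE/= inordK//=.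
  by rewrite (le_trans (FM _ _ _ _ _ _))// ler_norm.
by rewrite (le_trans bM)// -mulrA -natrM ler_wpM2l.
Qed.

(* The potential at [x] is the length of a shortest path from [o] to [x], where
   the edge from [x] to [y] has length [a x y + K]: there are no negative cycles. *)
Lemma exists_potential (a : X -> X -> R) (K : R) (o : X) :
  (forall t n, unit_steps t -> t n = t 0 -> `|steps_sum a t n| <= K * n%:R) ->
  exists h : X -> R, forall x y, near_points 1 x y ->
    `|a x y - (h y - h x)| <= 3 * K.
Proof.
move=> aK.
pose S x : set R := [set v | exists t n,
  [/\ unit_steps t, t 0 = o, t n = x & v = steps_sum a t n + K * n%:R]].
have S0 x : S x !=set0.
  by have [t [n [t1 t0 tn]]] := exists_steps o x; eexists; exists t, n.
(* Closing all paths to [x] by one fixed way back turns the bound on closed paths into a lower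
   bound. *)
have Slb x : has_lbound (S x).
  have [s [k [s1 s0 sk]]] := exists_steps x o.
  exists (- (steps_sum a s k + K * k%:R)) => _ [t [n [t1 t0 tn ->]]].
  have [|u1 u0 uE aE] := concat_stepsP t1 s1 (_ : t n = s 0); first by rewrite tn s0.
  have := aK _ (n + k)%N u1; rewrite uE u0 sk t0 => /(_ erefl).
  by rewrite aE natrD ler_norml => /andP[+ _]; lra.
pose h x := inf (S x).
have hstep x y : near_points 1 x y -> h y - h x <= a x y + K.
  move=> xy; suff : h y - (a x y + K) <= h x by lra.
  apply: lb_le_inf => // _ [t [n [t1 t0 tn ->]]].
  have [//|u1 u0 uE aE] := concat_stepsP t1 (edge_stepsP xy) (_ : t n = x).
  rewrite lerBlDr; apply: ge_inf => //;
    exists (concat_steps t n (edge_steps x y)), (n + 1)%N.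
  split; [exact: u1|by rewrite u0|by rewrite uE|].
  by rewrite aE steps_sumS /= /steps_sum big_ord0 addr0 natrD; ring.
exists h => x y xy.
have yx : near_points 1 y x by rewrite /near_points metric_sym.
have := hstep _ _ xy; have := hstep _ _ yx.
(* The path from [x] to [y] and back shows that [a x y + a y x] is at most [2 * K] in absolute
   value. This turns [hstep] for [y, x] into the missing inequality, with the factor 3. *)
have [//|u1 u0 uE aE] :=
  concat_stepsP (edge_stepsP xy) (edge_stepsP yx) (_ : edge_steps x y 1 = y).
have := aK _ (1 + 1)%N u1; rewrite uE u0 aE => /(_ erefl).
rewrite !steps_sumS /steps_sum !big_ord0 /= !addr0 !ler_norml natrD.
move=> /andP[a1 a2] h1 h2; apply/andP; split; lra.
Qed.

(** On cycles of unit edges [f] is bounded by [3 * K], and its extension [G] yields a bounded [g0].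
    Since [F x0 - g0] sums to 0 over closed paths, it is at scale 1 the gradient of some [h]. Then
    [F x0] minus the gradient of [h] is a primitive of [F], and at scale 1 it equals [g0]. *)
Lemma hyperbolic_coarse_vanishing (V : completeNormedModType R) :
  hyperbolic X -> one_injective V -> coarse_vanishing (@near_points R X) V.
Proof.
move=> hypX injV F Fc Fb.
have [[x0 _]|noX] := pselect (exists o : X, True); last first.
  exists (fun _ _ => 0); last by move=> x; exfalso; apply: noX; exists x.
  by move=> r; exists 0 => x; exfalso; apply: noX; exists x.
have [K K0 FK] := hyperbolic_cocycle_sum hypX Fc Fb.
pose W := l1space R (X * X)%type.
pose close (b : W) := forall k, k \in msupp b -> near_points 1 k.1 k.2.
pose grad (h : X -> R) (k : X * X) : R^o := h k.2 - h k.1.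
(* Cycles are described by duality, as the chains that every gradient annihilates. *)
pose U : {pred W} := [pred b : W | `[< close b /\
  forall h : X -> R, lext (grad h) b = 0 >]].
have UP b : reflect (close b /\ forall h : X -> R, lext (grad h) b = 0) (b \in U).
  exact: asboolP.
have closeD a (b c : W) : close b -> close c -> close (a *: b + c).
  move=> bc cc k /(fsubsetP (msuppD_le _ _)); rewrite in_fsetU => /orP[|/cc//].
  by move=> /(fsubsetP (msuppZ_le _ _)) /bc.
have close0 : close 0 by move=> k; rewrite msupp0.
have Usub : submod_closed U.
  split; first by apply/UP; split => // h; rewrite linear0.
  move=> a b c /UP[bc bh] /UP[cc ch]; apply/UP; split; first exact: closeD.
  by move=> h; rewrite linearP/= bh ch scaler0 addr0.
pose Fo (k : X * X) := F x0 k.1 k.2.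
pose f : W -> V := lext Fo.
(* A norming functional reduces this to real values, where [exists_potential] applies: subtracting
   the gradient of [h] keeps the value on the cycle [b] and makes the coefficients at most
   [3 * K]. *)
have fU : {in U, forall b, `|f b| <= 3 * K * `|b|}.
  move=> b /UP[bc bh].
  have [l [ll lv lb]] := norming_functional (f b).
  have [L LE] : exists L : {linear V -> R^o}, l = L by exact: linear_fun.
  have [h hP] : exists h : X -> R, forall x y, near_points 1 x y ->
      `|l (F x0 x y) - (h y - h x)| <= 3 * K.
    apply: (exists_potential x0) => t n t1 tn.
    apply: le_trans (FK x0 t n t1 tn); apply: le_trans (lb _).
    by rewrite LE /steps_sum raddf_sum.
  have lfE : l (f b) = lext (fun k => (l (F x0 k.1 k.2) - (h k.2 - h k.1) : R^o)) b.
    transitivity (lext (fun k => (l (Fo k) : R^o)) b - lext (grad h) b).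
      rewrite bh subr0 LE /f /lext raddf_sum/=; apply: eq_bigr => k _.
      by rewrite linearZ.
    rewrite /lext -sumrB; apply: eq_bigr => k _.
    by rewrite -scalerBr.
  rewrite -lv; apply: le_trans (ler_norm _) _; rewrite lfE.
  by apply: ler_norm_lext => k /bc; exact: hP.
have fl a : {in U &, forall b c, f (a *: b + c) = a *: f b + f c}.
  by move=> b c _ _; rewrite /f linearP.
have [|G [GU [M [M0 GM]] _]] := injV W U f Usub fl.
  by exists (3 * K); split => //; rewrite mulr_ge0.
pose g0 x y : V := G << (x, y) >>.
have g0M x y : `|g0 x y| <= M.
  apply: le_trans (GM _ isT) _.
  have -> : `|<< (x, y) >> : W| = 1 by exact: l1U.
  by rewrite mulr1.
pose d x y := F x0 x y - g0 x y.
have d_cycle t n : unit_steps t -> t n = t 0 -> steps_sum d t n = 0.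
  move=> t1 tn.
  pose b : W := steps_sum (fun x y => << (x, y) >> : W) t n.
  have lextb (V' : lmodType R) (a : X * X -> V') :
      lext a b = steps_sum (fun x y => a (x, y)) t n.
    by rewrite /b /steps_sum raddf_sum; apply: eq_bigr => i _; exact: lextU.
  have Ub : b \in U.
    apply/UP; split.
      apply: (big_ind close) => // [c c' cc c'c|i _].
        by rewrite -[c]scale1r; exact: closeD.
      by move=> k; rewrite msuppU oner_eq0 inE => /eqP ->; exact: t1.
    move=> h; rewrite lextb /steps_sum /grad/=.
    rewrite -(big_mkord xpredT (fun i => h (t i.+1) - h (t i))).
    by rewrite telescope_sumr// tn subrr.
  rewrite /d /steps_sum sumrB; apply/eqP; rewrite subr_eq0; apply/eqP.
  transitivity (f b); first by rewrite /f lextb.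
  by rewrite -GU// /b /steps_sum raddf_sum.
pose P x (tn : (nat -> X) * nat) := [/\ unit_steps tn.1, tn.1 0 = x0 & tn.1 tn.2 = x].
have [|p pP] := @choice _ _ P.
  by move=> x; have [t [n tP]] := exists_steps x0 x; exists (t, n).
(* The integral of [d] along a chosen path from [x0]. Different paths agree, as a common way back
   closes them up and [d_cycle] applies. *)
pose h x := steps_sum d (p x).1 (p x).2.
have hd x y : near_points 1 x y -> h y - h x = d x y.
  move=> xy; have [s [k [s1 s0 sk]]] := exists_steps y x0.
  have [px1 px0 pxn] := pP x; have [py1 py0 pyn] := pP y.
  have [|u1 u0 uE uS] := concat_stepsP py1 s1 (_ : (p y).1 (p y).2 = s 0).
    by rewrite pyn s0.
  have := d_cycle _ _ u1 (etrans (uE k) (etrans sk (esym (etrans u0 py0)))).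
  rewrite uS -/(h y) => /eqP; rewrite addr_eq0 => /eqP ->.
  have [//|v1 v0 vE vS] := concat_stepsP px1 (edge_stepsP xy) (_ : (p x).1 (p x).2 = x).
  set v := concat_steps _ _ _ in v1 v0 vE vS.
  have [|w1 w0 wE wS] := concat_stepsP v1 s1 (_ : v ((p x).2 + 1)%N = s 0).
    by rewrite vE s0.
  have := d_cycle _ _ w1 (etrans (wE k) (etrans sk (esym (etrans w0 (etrans v0 px0))))).
  rewrite wS vS steps_sumS /= -/(h x) [steps_sum _ _ 0]big_ord0 addr0 => /eqP.
  by rewrite addr_eq0 => /eqP <-; rewrite addrC addKr.
pose g x y := F x0 x y - (h y - h x).
have gE x y z : F x y z = g y z - g x z + g x y.
  rewrite (cocycle2_primitive x0 Fc) /g.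
  by zmod_eq.
exists g; last exact: gE.
(* Larger scales follow by splitting a geodesic at [z]: the primitive identity on [x, z, y] costs
   one value of [F] at scale [r.+1]. *)
elim=> [|r [B gB]].
  exists M => x y xy; rewrite /g hd; last exact: le_trans xy _.
  by rewrite /d opprB addrC subrK.
have [N FN] := Fb r.+1; exists (M + B + N) => x y.
rewrite /near_points -natr1 addrC => xyr.
have [//|//|z xz zy] := geodesic_split geoX (_ : 0 <= 1 :> R) (_ : 0 <= r%:R) xyr.
have -> : g x y = g x z + g z y - F x z y by rewrite gE; zmod_eq.
have gxz : `|g x z| <= M by rewrite /g hd// /d opprB addrC subrK.
rewrite (le_trans (ler_normB _ _))// lerD//.
  by rewrite (le_trans (ler_normD _ _))// lerD// gB.
apply: FN; rewrite /near_points -natr1 addrC//.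
  by rewrite (le_trans xz)// lerDl.
by rewrite (le_trans zy)// lerDr.
Qed.

End Vanishing.

(** * Integrals of area forms *)

Section AreaForms.
Variables (R : realType) (X : metricType R).
Implicit Types (f g : X -> R).

Definition lipschitz1 f : Prop := forall x y, `|f x - f y| <= mdist x y.

(** The discrete 1-form [f dg], whose differential is the area form [df dg]. *)
Definition area_form f g (x y : X) : R := f x * (g y - g x).

Definition linear_area_bound (K : R) : Prop :=
  forall f g t n, lipschitz1 f -> lipschitz1 g -> unit_steps t -> t n = t 0 ->
    `|steps_sum (area_form f g) t n| <= K * n%:R.

Lemma linf_sumE n (u : 'I_n -> linf R) k : (\sum_i u i) k = \sum_i u i k.
Proof. exact: (big_morph (fun v : linf R => v k)). Qed.

(** If every constant fails, each [k] has a pair of functions and a closed path that violate the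
    bound [k]. The cocycles of these pairs are the coordinates of [F], and a bound [M] of its
    primitive at scale 1 contradicts the [k]-th path once [k] exceeds [M]. *)
Lemma coarse_vanishing_area_bound :
  coarse_vanishing (@near_points R X) (linf R) ->
  exists2 K, 0 <= K & linear_area_bound K.
Proof.
move=> van; apply: contrapT => noK.
have /choice[D DP] : forall k : nat,
    exists D : (X -> R) * (X -> R) * (nat -> X) * nat,
    [/\ lipschitz1 D.1.1.1, lipschitz1 D.1.1.2, unit_steps D.1.2,
        D.1.2 D.2 = D.1.2 0 &
        k%:R * D.2%:R < `|steps_sum (area_form D.1.1.1 D.1.1.2) D.1.2 D.2| ].
  move=> k; apply: contrapT => noD; apply: noK; exists k%:R => // f g t n fl gl t1 tn.
  by rewrite leNgt; apply/negP => h; apply: noD; exists (f, g, t, n).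
pose f k := (D k).1.1.1; pose g k := (D k).1.1.2.
pose w x y z k := (f k y - f k x) * (g k z - g k y).
have w_le x y z k : `|w x y z k| <= mdist x y * mdist y z.
  have [fl gl _ _ _] := DP k.
  by rewrite normrM; apply: ler_pM => //; rewrite distrC; [exact: fl|exact: gl].
have wb x y z : w x y z \in @bounded_seq R.
  by apply/bounded_seqP; exists (mdist x y * mdist y z).
pose F x y z : linf R := Linf (wb x y z).
have [||G Gb GE] := van F.
- move=> x y z v; apply/val_inj/funext => k.
  rewrite -[LHS]/(w y z v k - w x z v k + w x y v k - w x y z k) -[RHS]/(0 : R).
  by rewrite /w; ring.
- move=> r; exists (r%:R * r%:R) => x y z xy _ yz; apply: linf_norm_le => k.
  by apply: le_trans (w_le _ _ _ _) _; apply: ler_pM => //; exact: mdist_ge0.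
have [M GM] := Gb 1; have [k kM] := exists_nat_gt M.
have [_ _] := DP k; set t := (D k).1.2; set n := (D k).2; move=> t1 tn.
rewrite ltNge => /negP; apply.
(* The two terms of the primitive identity that contain [t 0] telescope along the closed path. *)
have sumE : steps_sum (F (t 0)) t n = steps_sum G t n.
  rewrite /steps_sum.
  under eq_bigr do rewrite GE.
  rewrite big_split/= sumrB -addrA [- _ + _]addrC -sumrB -[RHS]addr0; congr (_ + _).
  rewrite -(big_mkord xpredT (fun i => G (t 0) (t i) - G (t 0) (t i.+1))).
  under eq_bigr do rewrite -opprB.
  by rewrite sumrN telescope_sumr// tn subrr oppr0.
(* In coordinate [k], [F (t 0)] is [f dg] with [f] shifted by a constant, and [dg] sums to 0 over a
   closed path. *)
have -> : steps_sum (area_form (f k) (g k)) t n = steps_sum (F (t 0)) t n k.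
  rewrite /steps_sum linf_sumE /= /w /area_form.
  under [RHS]eq_bigr do rewrite mulrBl.
  rewrite sumrB -mulr_sumr -(big_mkord xpredT (fun i => g k (t i.+1) - g k (t i))).
  by rewrite telescope_sumr// tn subrr mulr0 subr0.
apply: le_trans (le_linf_norm _ k) _; rewrite sumE.
apply: (@le_trans _ _ (M * n%:R)); last by rewrite ler_wpM2r// ltW.
rewrite -[linf_norm _]/(`|steps_sum G t n|).
apply: le_trans (ler_norm_sum _ _ _) _.
apply: (@le_trans _ _ (\sum_(i < n) M)).
  by apply: ler_sum => i _; apply: GM; exact: t1.
by rewrite sumr_const card_ord mulr_natr.
Qed.

End AreaForms.

(** * Fat triangles *)

Section Walks.
Variables (R : realType) (X : metricType R).
Implicit Types (x y z p q e : X) (A S : set X) (l : R).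

Definition walk A x y l : Prop :=
  exists (t : nat -> X) (n : nat), [/\ unit_steps t, t 0 = x, t n = y,
    forall i, (i <= n)%N -> A (t i) & n%:R <= l].

Lemma walk_refl A x : A x -> walk A x x 0.
Proof.
by move=> Ax; exists (fun=> x), 0; split => // i; rewrite mdistxx.
Qed.

Lemma walk_le A x y l l' : l <= l' -> walk A x y l -> walk A x y l'.
Proof.
move=> ll' [t [n [? ? ? ? nl]]]; exists t, n; split => //.
exact: le_trans ll'.
Qed.

Lemma walk_trans A x y z l l' :
  walk A x y l -> walk A y z l' -> walk A x z (l + l').
Proof.
move=> [t [n [t1 t0 tn tA nl]]] [s [k [s1 s0 sk sA kl']]].
have [|u1 u0 uE _] := concat_stepsP t1 s1 (_ : t n = s 0); first by rewrite tn s0.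
exists (concat_steps t n s), (n + k)%N; split => //.
- by rewrite u0.
- by rewrite uE.
- move=> i ink; rewrite /concat_steps; case: ltnP => [lt_in|le_ni].
    by apply: tA; exact: ltnW.
  by apply: sA; rewrite leq_subLR.
- by rewrite natrD lerD.
Qed.

Lemma walk_sym A x y l : walk A x y l -> walk A y x l.
Proof.
move=> [t [n [t1 t0 tn tA nl]]]; exists (fun i => t (n - i)%N), n; split => //.
- move=> i; have [lt_in|le_ni] := ltnP i n.
    by rewrite metric_sym -(subnSK lt_in); exact: t1.
  have -> : (n - i = 0)%N by apply/eqP; rewrite subn_eq0.
  have -> : (n - i.+1 = 0)%N by apply/eqP; rewrite subn_eq0 leqW.
  by rewrite mdistxx.
- by rewrite subn0.
- by rewrite subnn.
- by move=> i _; apply: tA; exact: leq_subr.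
Qed.

(** Unit steps clipped at [v]; rounding their number up costs the extra 1. *)
Lemma exists_subdivision (u v : R) : u <= v -> exists (w : nat -> R) (n : nat),
  [/\ w 0 = u, w n = v, forall i, u <= w i <= v,
      forall i, 0 <= w i.+1 - w i <= 1 & n%:R <= v - u + 1].
Proof.
move=> uv; exists (fun i => Num.min (u + i%:R) v), (Num.truncn (v - u)).+1.
have uv0 : 0 <= v - u by rewrite subr_ge0.
have /andP[nv vn] := truncn_itv uv0.
split.
- by rewrite addr0; apply/min_idPl.
- by apply/min_idPr; lra.
- by move=> i; rewrite le_min ge_min lexx orbT uv lerDl ler0n.
- move=> i; rewrite -natr1; case: (leP (u + i%:R) v); case: (leP (u + (i%:R + 1)) v);
    by move=> ? ?; apply/andP; split; lra.
- by rewrite -natr1; lra.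
Qed.

Lemma segment_sym x y S : geodesic_segment x y S -> geodesic_segment y x S.
Proof.
move=> [g [g0 gd gP] SE]; exists (fun s => g (mdist x y - s)).
  rewrite /geodesic_from_to (metric_sym y x).
  split; [by rewrite subr0|by rewrite subrr|] => s t /andP[s0 sd] /andP[t0 td].
  rewrite gP; [|by apply/andP; split; lra|by apply/andP; split; lra].
  by rewrite distrC; congr `|_|; lra.
rewrite SE; apply/seteqP; split => _ [s /= /andP[s0 sd] <-].
  exists (mdist x y - s) => /=; last by congr g; lra.
  by rewrite (metric_sym y x); apply/andP; split; lra.
rewrite (metric_sym y x) in sd.
by exists (mdist x y - s) => //=; apply/andP; split; lra.
Qed.

Lemma geodesic_arc (g : R -> X) x y u v : geodesic_from_to g x y ->
  0 <= u -> u <= v -> v <= mdist x y ->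
  exists (w : nat -> R) (n : nat),
    [/\ unit_steps (g \o w), w 0 = u, w n = v, forall i, u <= w i <= v &
        (forall i, 0 <= w i.+1 - w i) /\ n%:R <= v - u + 1].
Proof.
move=> [_ _ gP] u0 uv vd; have [w [n [w0 wn wuv w1 nuv]]] := exists_subdivision uv.
have wd i : 0 <= w i <= mdist x y.
  by have /andP[? ?] := wuv i; apply/andP; split; lra.
exists w, n; split => //; last first.
  by split => // i; have /andP[] := w1 i.
move=> i; rewrite /= gP// distrC; have /andP[? ?] := w1 i.
by rewrite ger0_norm.
Qed.

Lemma arc_walk A g x y u v : geodesic_from_to g x y ->
  0 <= u -> u <= v -> v <= mdist x y ->
  (forall w, u <= w <= v -> A (g w)) -> walk A (g u) (g v) (v - u + 1).
Proof.
move=> gP u0 uv vd gA; have [w [n [w1 w0 wn wuv [_ nuv]]]] := geodesic_arc gP u0 uv vd.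
exists (g \o w), n; split => //=; rewrite ?w0 ?wn// => i _.
by apply: gA; exact: wuv.
Qed.

Lemma segment_walk A x y S p q : geodesic_segment x y S -> S p -> S q ->
  S `<=` A -> walk A p q (mdist p q + 1).
Proof.
move=> [g gxy ->] [u /= uP <-] [v /= vP <-] SA.
have [_ _ gP] := gxy; rewrite gP//.
have arc u' v' : u' <= v' -> 0 <= u' <= mdist x y -> 0 <= v' <= mdist x y ->
    walk A (g u') (g v') (v' - u' + 1).
  move=> uv /andP[u0 ud] /andP[v0 vd]; apply: (arc_walk gxy) => // w /andP[uw wv].
  by apply: SA; exists w => //=; apply/andP; split; lra.
have [uv|vu] := leP u v.
  by rewrite distrC ger0_norm ?subr_ge0//; exact: arc.
by rewrite gtr0_norm ?subr_gt0//; apply: walk_sym; apply: arc => //; exact: ltW.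
Qed.

Lemma geodesic_walk A p q : geodesic_space X ->
  (forall w, mdist p w + mdist w q = mdist p q -> A w) ->
  walk A p q (mdist p q + 1).
Proof.
move=> /exists_geodesic_segment/(_ p q)[S SP] pqA.
have [g [g0 gd gP] SE] := SP.
apply: (segment_walk SP).
- by rewrite SE; exists 0; rewrite ?g0//= lexx mdist_ge0.
- by rewrite SE; exists (mdist p q); rewrite ?gd//= lexx mdist_ge0.
- by move=> w /(geodesic_segmentE SP)/pqA.
Qed.

Lemma segment_advance x y S p l : geodesic_segment x y S -> S p -> 0 <= l ->
  mdist p y <= l \/
  exists2 e, S e & mdist p e = l /\ mdist x e = mdist x p + l.
Proof.
move=> SP Sp l0; have [g [g0 gd gP] SE] := SP.
have := Sp; rewrite SE => -[u /= /andP[u0 ud] gu].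
have d0 := mdist_ge0 x y.
have xp : mdist x p = u by rewrite -{1}g0 -gu gP ?lexx ?u0// sub0r normrN ger0_norm.
have := geodesic_segmentE SP Sp; rewrite xp => py.
have [?|ld] := leP (mdist p y) l; [by left|right].
have uld : 0 <= u + l <= mdist x y by apply/andP; split; lra.
exists (g (u + l)); first by exists (u + l).
split; first by rewrite -gu gP ?u0// opprD addrA subrr sub0r normrN ger0_norm.
have /andP[ul0 _] := uld.
by rewrite -{1}g0 gP ?lexx//= sub0r normrN ger0_norm.
Qed.

End Walks.

Section FatTriangle.
Variables (R : realType) (X : metricType R).
Hypothesis geoX : geodesic_space X.

Lemma lipschitz1_mdist (a : X) : lipschitz1 (mdist a).
Proof.
move=> x y; rewrite ler_norml; apply/andP; split.
  have := metric_triangle a x y; lra.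
have := metric_triangle a y x; rewrite (metric_sym y x); lra.
Qed.

Lemma lipschitz1_bump (x : X) (t : R) :
  lipschitz1 (fun p => Num.max 0 (t - mdist x p)).
Proof.
move=> p q; have := lipschitz1_mdist x p q; rewrite !ler_norml => /andP[h1 h2].
have d0 := mdist_ge0 p q.
by case: (leP 0 (t - mdist x p)) => ?; case: (leP 0 (t - mdist x q)) => ?;
  apply/andP; split; lra.
Qed.

(* The integrand is nonnegative, and the bump is at least [t / 2] on the middle
   part of the arc, which has length [t]. *)
Lemma bump_arc_integral (a b : X) g (u0 t u v : R) :
  geodesic_from_to g a b -> 0 <= u -> v <= mdist a b -> 0 < t ->
  u <= u0 - t -> u0 + t <= v ->
  exists (s : nat -> X) (n : nat),
    [/\ unit_steps s, s 0 = g u, s n = g v, n%:R <= v - u + 3 &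
      t ^+ 2 / 2 <= steps_sum
        (area_form (fun p => Num.max 0 (t - mdist (g u0) p)) (mdist a)) s n].
Proof.
move=> gab u_ge0 vd t0 uu0 u0v.
set f := (fun p : X => Num.max _ _).
have [g0 _ gP] := gab.
have dg w : 0 <= w <= mdist a b -> mdist a (g w) = w.
  move=> /andP[w0 wd]; rewrite -{1}g0 gP ?w0//; last by rewrite lexx (le_trans w0).
  by rewrite sub0r normrN ger0_norm.
have arc (m u1 v1 : R) : 0 <= u1 -> u1 <= v1 -> v1 <= mdist a b ->
    (forall w, u1 <= w <= v1 -> m <= f (g w)) ->
    exists (s : nat -> X) (n : nat),
      [/\ unit_steps s, s 0 = g u1, s n = g v1, n%:R <= v1 - u1 + 1 &
      m * (v1 - u1) <= steps_sum (area_form f (mdist a)) s n].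
  move=> u10 uv1 v1d fm.
  have [w [n [w1 w0 wn wuv [wS nuv]]]] := geodesic_arc gab u10 uv1 v1d.
  have wd i : 0 <= w i <= mdist a b.
    by have /andP[? ?] := wuv i; apply/andP; split; lra.
  exists (g \o w), n; split => //=; rewrite ?w0 ?wn//.
  rewrite -w0 -wn -telescope_sumr// big_mkord mulr_sumr; apply: ler_sum => i _.
  rewrite /area_form /= !dg//; apply: ler_wpM2r => //.
  by apply: fm; exact: wuv.
have f_ge0 p : 0 <= f p by rewrite /f le_max lexx.
(* Each of the three arcs is rounded up by one step, which makes the 3 in the length bound. *)
have [||||s1 [n1 [s11 s10 s1n n1l I1]]] := arc 0 u (u0 - t / 2) => //; try lra.
have [||||s2 [n2 [s21 s20 s2n n2l I2]]] := arc (t / 2) (u0 - t / 2) (u0 + t / 2).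
- lra.
- lra.
- lra.
- move=> w /andP[uw wv]; rewrite /f le_max; apply/orP; right.
  rewrite gP; [|by apply/andP; split; lra|by apply/andP; split; lra].
  suff : `|u0 - w| <= t / 2 by lra.
  by rewrite ler_norml; apply/andP; split; lra.
have [||||s3 [n3 [s31 s30 s3n n3l I3]]] := arc 0 (u0 + t / 2) v => //; try lra.
have [|p1 p0 pE pI] := concat_stepsP s11 s21 (_ : s1 n1 = s2 0).
  by rewrite s1n s20.
set p := concat_steps _ _ _ in p1 p0 pE pI.
have [|q1 q0 qE qI] := concat_stepsP p1 s31 (_ : p (n1 + n2)%N = s3 0).
  by rewrite pE s2n s30.
exists (concat_steps p (n1 + n2) s3), (n1 + n2 + n3)%N; split => //.
- by rewrite q0 p0.
- by rewrite qE.
- by rewrite !natrD; lra.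
- by rewrite qI pI expr2; lra.
Qed.

End FatTriangle.

(** * Detours around a point far from the other sides, and the descent to a uniform constant *)

Section FatTriangle.
Variables (R : realType) (X : metricType R).
Hypothesis geoX : geodesic_space X.

Lemma segment_ends (a b : X) S : geodesic_segment a b S -> S a /\ S b.
Proof.
move=> [g [g0 gd _] ->]; have d0 := mdist_ge0 a b.
by split; [exists 0|exists (mdist a b)] => //=; rewrite lexx d0.
Qed.

(** The arc is cut off [4 * t] before and after [x], or at the ends of the side. Its ends are joined
    to points [y'] and [z'] of the other sides, at most [6 * t] from [x], and these to each other
    outside the ball. The longest combination of walks costs [60 * t + 5]. *)
Lemma fat_triangle_detour (a b c : X) g S1 S2 S3 (u0 t : R) :
  geodesic_from_to g a b -> S1 = g @` [set s | 0 <= s <= mdist a b] ->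
  geodesic_segment b c S2 -> geodesic_segment c a S3 ->
  0 <= u0 <= mdist a b -> 1 <= t ->
  (forall q, (S2 `|` S3) q -> t < mdist (g u0) q) ->
  (forall p, S1 p -> exists2 q, (S2 `|` S3) q & mdist p q <= 2 * t) ->
  (forall p, S3 p -> exists2 q, (S1 `|` S2) q & mdist p q <= 2 * t) ->
  exists u v, [/\ 0 <= u, u0 - 4 * t <= u <= u0 - t, u0 + t <= v <= u0 + 4 * t,
    v <= mdist a b & walk [set w | t <= mdist (g u0) w] (g v) (g u) (70 * t)].
Proof.
move=> gab S1E bcS2 caS3 u0d t1 far slim1 slim3.
set x := g u0 in far *; set A := [set w | _].
have /andP[u0_ge0 u0_le] := u0d.
have [g0 gd gP] := gab.
have dg v : 0 <= v <= mdist a b -> mdist a (g v) = v.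
  move=> /andP[v0 vd]; rewrite -{1}g0 gP ?v0//; last by rewrite lexx (le_trans v0).
  by rewrite sub0r normrN ger0_norm.
have S2A : S2 `<=` A by move=> w S2w; apply: ltW; apply: far; left.
have S3A : S3 `<=` A by move=> w S3w; apply: ltW; apply: far; right.
have [S2b S2c] := segment_ends bcS2; have [S3c S3a] := segment_ends caS3.
have ta : t < u0 by rewrite -(dg u0)// metric_sym; apply: far; right.
have tb : t < mdist a b - u0.
  have := far b (or_introl S2b); rewrite /x -gd gP ?lexx ?(le_trans u0_ge0)//.
  by rewrite gd distrC ger0_norm ?subr_ge0.
(* A geodesic from [g v] to [q] stays within [2 * t] of [g v], which is [4 * t] away from [x], so it
   avoids the ball. *)
have near_side v : 0 <= v <= mdist a b -> `|u0 - v| = 4 * t ->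
    exists2 q, (S2 `|` S3) q & mdist (g v) q <= 2 * t /\ walk A (g v) q (2 * t + 1).
  move=> vd uv; have [|q S23q vq] := slim1 (g v); first by rewrite S1E; exists v.
  exists q => //; split => //; apply: walk_le (geodesic_walk geoX _); first by lra.
  move=> w vwq; rewrite /A/=.
  have xv : mdist x (g v) = 4 * t by rewrite /x gP.
  have := metric_triangle x w (g v); rewrite (metric_sym w (g v)).
  by have := mdist_ge0 w q; lra.
have [u [y' [u_ge0 /andP[uu0 u0u] S23y' [yy' walky]]]] : exists u y',
    [/\ 0 <= u, u0 - 4 * t <= u <= u0 - t, (S2 `|` S3) y' &
    mdist (g u) y' <= 2 * t /\ walk A (g u) y' (2 * t + 1)].
  (* If [a] is within [4 * t] of [x], the arc starts at [a], which already lies on [S3]. *)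
  have [u0t|tu0] := leP u0 (4 * t).
    exists 0, a; rewrite g0 mdistxx; split; [by []| |by right|split].
    - by apply/andP; split; lra.
    - by lra.
    - by apply: walk_le (walk_refl (S3A _ S3a)); lra.
  have [||q S23q qP] := near_side (u0 - 4 * t).
  - by apply/andP; split; lra.
  - by rewrite ger0_norm; lra.
  - by exists (u0 - 4 * t), q; split => //; [lra|apply/andP; split; lra].
have [v [z' [v_le /andP[u0v vu0] S23z' [zz' walkz]]]] : exists v z',
    [/\ v <= mdist a b, u0 + t <= v <= u0 + 4 * t, (S2 `|` S3) z' &
    mdist (g v) z' <= 2 * t /\ walk A (g v) z' (2 * t + 1)].
  have [u0t|tu0] := leP (mdist a b) (u0 + 4 * t).
    exists (mdist a b), b; rewrite gd mdistxx; split; [by []| |by left|split].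
    - by apply/andP; split; lra.
    - by lra.
    - by apply: walk_le (walk_refl (S2A _ S2b)); lra.
  have [||q S23q qP] := near_side (u0 + 4 * t).
  - by apply/andP; split; lra.
  - by rewrite ler0_norm; lra.
  - by exists (u0 + 4 * t), q; split => //; [lra|apply/andP; split; lra].
exists u, v; split => //; [by apply/andP|by apply/andP|].
apply: walk_sym.
have ud : 0 <= u <= mdist a b by apply/andP; split; lra.
have vd : 0 <= v <= mdist a b by apply/andP; split; lra.
have yz : mdist (g u) (g v) = v - u by rewrite gP// distrC ger0_norm; lra.
have xy : mdist x (g u) = u0 - u by rewrite /x gP// ger0_norm; lra.
have xz : mdist x (g v) = v - u0 by rewrite /x gP// distrC ger0_norm; lra.
have ay := dg _ ud; have az := dg _ vd.
have xy' : mdist x y' <= 6 * t by have := metric_triangle x (g u) y'; lra.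
have xz' : mdist x z' <= 6 * t by have := metric_triangle x (g v) z'; lra.
have y'z' : mdist y' z' <= 12 * t.
  by have := metric_triangle y' x z'; rewrite (metric_sym y' x); lra.
have same_side S (p q : X) : geodesic_segment p q S -> S `<=` A -> S y' -> S z' ->
    walk A (g u) (g v) (70 * t).
  move=> SP SA Sy' Sz'.
  apply: walk_le (walk_trans walky
    (walk_trans (segment_walk SP Sy' Sz' SA) (walk_sym walkz))).
  by lra.
(* After [20 * t] along [S3] the point [e] is at least [14 * t] away from [x], so crossing over to
   [q] cannot enter the ball. *)
have leave_side e p : S3 e -> S3 p -> mdist p e = 20 * t -> mdist x p <= 6 * t ->
    exists2 q, (S1 `|` S2) q & [/\ mdist e q <= 2 * t, mdist x q <= 28 * t &
      walk A p q (22 * t + 2)].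
  move=> S3e S3p pe xp; have [q S12q eq] := slim3 e S3e; exists q => //; split => //.
    have := metric_triangle x p q; have := metric_triangle p e q; lra.
  apply: walk_le (walk_trans (segment_walk caS3 S3p S3e S3A) (geodesic_walk geoX _)).
    by lra.
  move=> w ewq; rewrite /A/=.
  have := metric_triangle p x e; rewrite (metric_sym p x).
  have := metric_triangle x w e; rewrite (metric_sym w e).
  by have := mdist_ge0 w q; lra.
have t20 : 0 <= 20 * t by lra.
(* If the sides differ, one follows [S3] for [20 * t], towards [a] if [z'] is on it and towards [c]
   if [y'] is. If its end comes earlier, one goes on along the next side; otherwise one crosses over
   at [e]. When this leads to [S1], the distance from [a] to [e] shows that one lands before [u] in
   the first case and after [v] in the second. *)
case: S23y' => [S2y'|S3y']; case: S23z' => [S2z'|S3z'].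
- exact: same_side bcS2 _ _ _.
- have [z'a|[e S3e [z'e ce]]] := segment_advance caS3 S3z' t20.
    have ua : u <= 32 * t.
      have := metric_triangle a z' (g u); rewrite (metric_sym a z').
      by have := metric_triangle z' x (g u); rewrite (metric_sym z' x); lra.
    have walka : walk A a (g u) (u + 1).
      rewrite -{1}g0 -[u in u + 1]subr0; apply: (arc_walk gab) => //; first by lra.
      move=> w /andP[w0 wu]; rewrite /A/= /x gP//; last by apply/andP; split; lra.
      by rewrite ger0_norm; lra.
    apply: walk_sym; apply: walk_le (walk_trans walkz
      (walk_trans (segment_walk caS3 S3z' S3a S3A) walka)).
    by lra.
  have ae : mdist a e = mdist a z' - 20 * t.
    have := geodesic_segmentE caS3 S3e; have := geodesic_segmentE caS3 S3z'.
    by rewrite (metric_sym e a) (metric_sym z' a); lra.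
  have [q [S1q|S2q] [eq xq walkq]] := leave_side _ _ S3e S3z' z'e xz'.
    move: S1q eq xq walkq; rewrite S1E => -[s sd <-] eq xq walkq.
    have /= /andP[s0 sab] := sd.
    have su : s <= u.
      have := metric_triangle a e (g s); rewrite dg//.
      by have := metric_triangle a (g v) z'; lra.
    have us : u0 - s <= 28 * t.
      by move: xq; rewrite /x gP// ger0_norm; lra.
    have walks : walk A (g s) (g u) (u - s + 1).
      apply: (arc_walk gab) => //; first by lra.
      move=> w /andP[w0 wu]; rewrite /A/= /x gP//; last by apply/andP; split; lra.
      by rewrite ger0_norm; lra.
    apply: walk_sym; apply: walk_le (walk_trans walkz (walk_trans walkq walks)).
    by lra.
  have qy' : mdist q y' <= 34 * t.
    by have := metric_triangle q x y'; rewrite (metric_sym q x); lra.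
  apply: walk_sym; apply: walk_le (walk_trans walkz (walk_trans walkq
    (walk_trans (segment_walk bcS2 S2q S2y' S2A) (walk_sym walky)))).
  by lra.
- have [y'c|[e S3e [y'e ae]]] :=
    segment_advance (segment_sym caS3) S3y' t20.
    have cz' : mdist c z' <= 32 * t.
      by have := metric_triangle c y' z'; rewrite (metric_sym c y'); lra.
    apply: walk_le (walk_trans walky (walk_trans (segment_walk caS3 S3y' S3c S3A)
      (walk_trans (segment_walk bcS2 S2c S2z' S2A) (walk_sym walkz)))).
    by lra.
  have [q [S1q|S2q] [eq xq walkq]] := leave_side _ _ S3e S3y' y'e xy'.
    move: S1q eq xq walkq; rewrite S1E => -[s sd <-] eq xq walkq.
    have /= /andP[s0 sab] := sd.
    have vs : v <= s.
      have := metric_triangle a (g s) e; rewrite (metric_sym (g s) e) dg//.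
      by have := metric_triangle a y' (g u); rewrite (metric_sym y' (g u)); lra.
    have us : s - u0 <= 28 * t.
      by move: xq; rewrite /x gP// distrC ger0_norm; lra.
    have walks : walk A (g v) (g s) (s - v + 1).
      apply: (arc_walk gab) => //; first by lra.
      move=> w /andP[w0 wu]; rewrite /A/= /x gP//; last by apply/andP; split; lra.
      by rewrite distrC ger0_norm; lra.
    apply: walk_le (walk_trans walky (walk_trans walkq (walk_sym walks))).
    by lra.
  have qz' : mdist q z' <= 34 * t.
    by have := metric_triangle q x z'; rewrite (metric_sym q x); lra.
  apply: walk_le (walk_trans walky (walk_trans walkq
    (walk_trans (segment_walk bcS2 S2q S2z' S2A) (walk_sym walkz)))).
  by lra.
- exact: same_side caS3 _ _ _.
Qed.

(** Otherwise the arc, of at most [8 * t + 3] steps, and the detour, of at most [70 * t], close up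
    to a loop of at most [81 * t] steps. Its integral is at least [t ^+ 2 / 2] and at most
    [K * (81 * t)], against [162 * K < t]. *)
Lemma no_fat_triangle (K : R) (a b c : X) S1 S2 S3 (t : R) :
  0 <= K -> linear_area_bound X K ->
  geodesic_segment a b S1 -> geodesic_segment b c S2 -> geodesic_segment c a S3 ->
  1 <= t -> 162 * K < t ->
  (forall p, S1 p -> exists2 q, (S2 `|` S3) q & mdist p q <= 2 * t) ->
  (forall p, S3 p -> exists2 q, (S1 `|` S2) q & mdist p q <= 2 * t) ->
  forall p, S1 p -> exists2 q, (S2 `|` S3) q & mdist p q <= t.
Proof.
move=> K0 area [g gab S1E] bcS2 caS3 t1 Kt slim1 slim3 p.
rewrite {1}S1E => -[u0 /= u0d <-]; apply: contrapT => nfar.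
have far q : (S2 `|` S3) q -> t < mdist (g u0) q.
  by move=> S23q; rewrite ltNge; apply/negP => h; apply: nfar; exists q.
have [u [v [u0_ge0 /andP[uu0 u0u] /andP[u0v vu0] vd [s [n [s1 s0 sn sA nl]]]]]] :=
  fat_triangle_detour gab S1E bcS2 caS3 u0d t1 far slim1 slim3.
have t0 : 0 < t by lra.
have [r [k [r1 r0 rk kl I]]] := bump_arc_integral gab u0_ge0 vd t0 u0u u0v.
set f := (fun p : X => Num.max _ _) in I.
have [|q1 q0 qE qI] := concat_stepsP r1 s1 (_ : r k = s 0); first by rewrite rk s0.
have := area f (mdist a) _ (k + n)%N (lipschitz1_bump _ _) (lipschitz1_mdist a) q1.
rewrite qE q0 sn r0 => /(_ erefl); rewrite qI.
(* The bump is 0 outside the ball, so the detour contributes nothing. *)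
have -> : steps_sum (area_form f (mdist a)) s n = 0.
  rewrite /steps_sum big1// => i _; rewrite /area_form.
  have -> : f (s i) = 0; last by rewrite mul0r.
  by apply/max_idPl; rewrite subr_le0; apply: (sA i); exact: ltnW.
rewrite addr0 => /(le_trans (ler_norm _))/(le_trans I).
rewrite natrD => h.
have : K * (k%:R + n%:R) <= K * (81 * t) by apply: ler_wpM2l => //; lra.
move=> /(le_trans h); rewrite expr2 leNgt => /negP; apply.
by have := @ltr_pM2r _ t t0 (162 * K) t; rewrite Kt => /idP; lra.
Qed.

(** A triangle is slim for some constant [2 ^+ n * t0] above its perimeter, and [no_fat_triangle]
    halves the constant until it is [t0], whatever the triangle. All three rotations are carried
    along, since each halving draws on the slimness of two sides. *)
Lemma area_bound_hyperbolic (K : R) :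
  0 <= K -> linear_area_bound X K -> hyperbolic X.
Proof.
move=> K0 area.
pose slim (t : R) (S1 S2 S3 : set X) :=
  forall p, S1 p -> exists2 q, (S2 `|` S3) q & mdist p q <= t.
pose slim3 t S1 S2 S3 := [/\ slim t S1 S2 S3, slim t S2 S3 S1 & slim t S3 S1 S2].
pose t0 := 162 * K + 1.
exists t0; first by rewrite /t0; lra.
move=> a b c S1 S2 S3 abS1 bcS2 caS3.
suff : slim3 t0 S1 S2 S3 by case.
have halve t : t0 <= t -> slim3 (2 * t) S1 S2 S3 -> slim3 t S1 S2 S3.
  rewrite /t0 => t0t [h1 h2 h3].
  have [t1 Kt] : 1 <= t /\ 162 * K < t by split; lra.
  split.
  - exact: (no_fat_triangle K0 area abS1 bcS2 caS3 t1 Kt).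
  - exact: (no_fat_triangle K0 area bcS2 caS3 abS1 t1 Kt).
  - exact: (no_fat_triangle K0 area caS3 abS1 bcS2 t1 Kt).
have desc n : slim3 (2 ^+ n * t0) S1 S2 S3 -> slim3 t0 S1 S2 S3.
  elim: n => [|n IH]; first by rewrite expr0 mul1r.
  rewrite exprS -mulrA => /halve h; apply/IH/h.
  rewrite ler_peMl//; first by rewrite /t0; lra.
  exact: exprn_ege1 (ler1n _ 2).
have [n nP] := exists_nat_gt (mdist a b + mdist b c + mdist c a).
apply: (desc n).
have big : mdist a b + mdist b c + mdist c a <= 2 ^+ n * t0.
  apply: le_trans (ltW nP) _.
  apply: (@le_trans _ _ (2 ^+ n)).
    by rewrite -natrX ler_nat ltnW// ltn_expl.
  by rewrite ler_peMr ?exprn_ge0// /t0; lra.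
have := mdist_ge0 a b; have := mdist_ge0 b c; have := mdist_ge0 c a => d1 d2 d3.
(* The end [y] of the side lies on the next side and is at most the length of the side away. *)
have slim_big x y z S S' S'' : geodesic_segment x y S -> geodesic_segment y z S' ->
    mdist x y <= 2 ^+ n * t0 -> slim (2 ^+ n * t0) S S' S''.
  move=> xyS yzS' xyn p Sp; have [S'y _] := segment_ends yzS'.
  exists y; first by left.
  have := geodesic_segmentE xyS Sp; have := mdist_ge0 x p; lra.
split.
- by apply: slim_big abS1 bcS2 _; lra.
- by apply: slim_big bcS2 caS3 _; lra.
- by apply: slim_big caS3 abS1 _; lra.
Qed.

End FatTriangle.

Theorem theorem1p1 (R : realType) (X : metricType R) :
  geodesic_space X ->
  [<-> hyperbolic X;
       finite_isoperimetric X /\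
         (forall V : completeNormedModType R,
            one_injective V -> cohomology_vanishes X V 2);
       finite_isoperimetric X /\ cohomology_vanishes X (linf R) 2].
Proof.
move=> geoX; tfae.
- move=> hypX; split; first exact: hyperbolic_finite_isoperimetric.
  move=> V injV Z _ XZ.
  by apply/(coarse_vanishing_quasi_isometric V XZ)/hyperbolic_coarse_vanishing.
- move=> [isoX van]; split => //; apply: van; exact: linf_one_injective.
- move=> [_ /(_ _ (unit_graph_connected geoX) (unit_graph_quasi_isometric geoX))].
  move=> /(coarse_vanishing_quasi_isometric _ (unit_graph_quasi_isometric geoX)).
  by move=> /coarse_vanishing_area_bound[K K0 /(area_bound_hyperbolic geoX K0)].
Qed.
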